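(* Let $T \subseteq 2^{<\omega}$ be a tree (not necessarily computable) with $\mu([T]) > 0$ and let $X \subseteq \omega$ be a non-computable set. Then there is a perfect tree $P \subseteq T$ such that $X \not\leq_T P$.
   Context: A (binary) tree is a subset of $2^{<\omega}$ closed under initial segments; $[T] \subseteq 2^\omega$ is the set of infinite paths through $T$; $\mu$ is the uniform (Lebesgue) measure on $2^\omega$. A tree $P$ is perfect if it is nonempty and equals the set of all initial segments of members of a nonempty perfect (closed, without isolated points) set $C \subseteq 2^\omega$ (equivalently, every node of $P$ has two incomparable extensions in $P$). *)

(* Defs.v *)
From Stdlib Require List.
From mathcomp Require Import all_boot all_order all_algebra.
From mathcomp Require Import all_classical all_reals all_analysis.

Set Implicit Arguments.
Unset Strict Implicit.
Unset Printing Implicit Defensive.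

Local Open Scope classical_set_scope.

(* Kleene's relativized partial recursive functions.  Programs are not indexed
   by an arity: they act on argument lists, an absent argument counting as 0. *)
Inductive code : Type :=
| Zero
| Succ
| Proj of nat
| Oracle
| Comp of code & seq code
| Prec of code & code
| Mu of code.

Definition char (A : set nat) (n : nat) : nat := nat_of_bool `[< A n >].

(* [eval A c x y]: with oracle A, program c halts on input x with output y.
   In [Prec f g] the recursion argument is the first one, and w lists the
   successive values; [Mu f] minimizes over the first argument of f, which
   must be defined and nonzero at every smaller value. *)
Fixpoint eval (A : set nat) (c : code) : seq nat -> nat -> Prop :=
  match c with
  | Zero => fun _ y => y = 0
  | Succ => fun x y => y = (head 0 x).+1
  | Proj i => fun x y => y = nth 0 x i
  | Oracle => fun x y => y = char A (head 0 x)
  | Comp f gs => fun x y => exists2 z : seq nat,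
      List.Forall2 (fun (r : seq nat -> nat -> Prop) v => r x v)
        (map (eval A) gs) z
      & eval A f z y
  | Prec f g => fun x y => exists w : nat -> nat,
      [/\ eval A f (behead x) (w 0),
          forall k, k < head 0 x ->
            eval A g [:: k, w k & behead x] (w k.+1)
        & y = w (head 0 x)]
  | Mu f => fun x y =>
      eval A f (y :: x) 0 /\
      forall k, k < y -> exists v, eval A f (k :: x) v.+1
  end.

Fixpoint oracle_free (c : code) : bool :=
  match c with
  | Oracle => false
  | Comp f gs => oracle_free f && all oracle_free gs
  | Prec f g => oracle_free f && oracle_free g
  | Mu f => oracle_free f
  | _ => true
  end.

(* The oracle is irrelevant here, as it is never queried. *)
Definition computable (X : set nat) : Prop :=
  exists2 c, oracle_free c & forall n, eval set0 c [:: n] (char X n).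

Definition turing_reducible (X A : set nat) : Prop :=
  exists c, forall n, eval A c [:: n] (char X n).

(* The length-lexicographic bijection from finite binary strings to nat: the
   children of the string numbered n are numbered 2n + 1 and 2n + 2. *)
Definition string_code (s : seq bool) : nat :=
  foldl (fun n (b : bool) => n.*2 + b.+1) 0 s.

Definition is_tree (T : set (seq bool)) : Prop :=
  forall s t, prefix s t -> T t -> T s.

Definition initial_segment (f : cantor_space) (n : nat) : seq bool :=
  mkseq f n.

Definition paths (T : set (seq bool)) : set cantor_space :=
  [set f | forall n, T (initial_segment f n)].

Definition cylinder (s : seq bool) : set cantor_space :=
  [set f | initial_segment f (size s) = s].

(* The uniform measure, as the outer measure generated by giving the cylinder
   of s the mass 2 ^- size s (cf. mu_ext, from which lebesgue_measure is
   obtained); on Borel sets, in particular on closed sets such as [paths T],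
   it is the coin-tossing probability measure. *)
Definition cantor_measure (R : realType) (E : set cantor_space) : \bar R :=
  ereal_inf [set (\sum_(i <oo) (2 ^- size (s i))%R%:E)%E
            | s in [set s : nat -> seq bool |
                    E `<=` \bigcup_i cylinder (s i)]].

Definition perfect_tree (P : set (seq bool)) : Prop :=
  exists C : set cantor_space,
    [/\ C !=set0, perfect_set C
      & P = [set s | exists f n, C f /\ s = initial_segment f n]].

(* Main.v *)
Require Import Defs.
From mathcomp Require Import all_boot all_order all_algebra.
From mathcomp Require Import all_classical all_reals all_analysis.
From mathcomp Require Import zify ring lra.
Import Defs.

(** The tree P is built by forcing.  A condition consists of a finite set of
leaves, all of one length, and of a reservoir Q, a subtree of T with positive
measure above each leaf; a stronger condition has leaves extending the old
ones and a smaller reservoir.  The finite trees below the leaves grow to P.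

Given a program c, the reservoir is first made to have density at least 3/4
above every leaf, by passing to longer leaves (Lebesgue density,
[dense_in_fat]).  Let n vary over the number of levels added above the leaves,
and say that (n, x, v) is forced ([forces]) if every finite tree with n new
levels that has density at least 1/2 above the leaves contains a pruned
subtree, with exactly the given leaves at the old level, from which c computes
the value v on input x.  This relation is decidable, since it speaks about
finitely many finite trees and only about computations bounded by their
height.  Hence one of three things happens.

- Some (n, x, v) with v different from X(x) is forced.  Apply this to the
  part of Q consisting of the strings above which Q has positive measure; it
  still has density 1/2 ([dense_fat_part]).  The subtree obtained gives new
  leaves, and every P that goes through them makes c output the wrong value v
  ([avoid_by_extension]).
- For some x, the correct value X(x) is forced for no n.  The finite
  counterexamples have by compactness a limit tree S, of density 1/2 above the
  leaves, and Q is replaced by its intersection with S, of density 1/4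
  ([avoid_by_thinning]).  A convergent computation of X(x) from some P inside
  S would use finitely many levels of P, and these lie in one of the
  counterexamples.
- Otherwise v = X(x) if and only if (n, x, v) is forced for some n, and
  searching for n computes X ([computable_of_forces]).

As X is not computable, c is defeated in all cases.  Treating all programs in
turn, and letting every leaf split at every stage, yields a perfect tree.

Measure enters only through the number of extensions of given length: if T has
positive measure, then T contains at least a fixed positive fraction of the
strings of each length ([fat_root]), and the density and intersection arguments
are inequalities between such numbers. *)

Set Implicit Arguments.
Unset Strict Implicit.
Unset Printing Implicit Defensive.

Local Open Scope classical_set_scope.

(** * Step-bounded evaluation of programs *)

(** The automatic induction principle gives no hypothesis for the list of
    subprograms of a composition. *)
Lemma code_nested_ind (P : code -> Prop) :
    P Zero -> P Succ -> (forall i, P (Proj i)) -> P Oracle ->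
    (forall f gs, P f -> List.Forall P gs -> P (Comp f gs)) ->
    (forall f g, P f -> P g -> P (Prec f g)) ->
    (forall f, P f -> P (Mu f)) ->
  forall c, P c.
Proof.
move=> P0 PS Pp Po Pc Pr Pm.
fix IH 1 => -[||i||f gs|f g|f].
- exact: P0.
- exact: PS.
- exact: Pp.
- exact: Po.
- apply: Pc; first exact: IH.
  by elim: gs => [|g gs IHgs]; constructor; [exact: IH|exact: IHgs].
- by apply: Pr; exact: IH.
- by apply: Pm; exact: IH.
Qed.

(** State of the search for a zero of a function whose values are coded as in
    [run]: 0 while the search goes on, 1 once it has met an undefined value,
    y + 2 once the zero y has been found. *)
Definition search (f : nat -> nat) (n : nat) : nat :=
  nat_rect (fun=> nat) 0
    (fun k st => if st == 0 then
                   if f k == 0 then 1 else if f k == 1 then k.+2 else 0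
                 else st) n.

Lemma search0 f n : search f n = 0 -> forall k, k < n -> 1 < f k.
Proof.
elim: n => //= n IH; rewrite -/(search f n).
case: eqP => [/IH{}IH|]; last by move=> + ?.
case: eqP => //; case: eqP => // n1 n0 _ k.
by rewrite ltnS leq_eqVlt => /predU1P[->|/IH//]; lia.
Qed.

Lemma searchS f n y : search f n = y.+2 ->
  f y = 1 /\ forall k, k < y -> 1 < f k.
Proof.
elim: n => //= n IH; rewrite -/(search f n).
case: eqP => [/search0 h|_ /IH//].
by case: eqP => // _; case: eqP => // fn [<-]; split.
Qed.

Lemma search_complete f n y : y < n -> f y = 1 ->
  (forall k, k < y -> 1 < f k) -> search f n = y.+2.
Proof.
move=> + fy lty; elim: n => //= n IH; rewrite -/(search f n) ltnS.
rewrite leq_eqVlt => /predU1P[yn|/IH->//].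
have -> : search f n = 0.
  rewrite -yn; elim: (y) lty => //= m IHm ltm; rewrite -/(search f m) IHm /=.
    by have := ltm m (leqnn _); case: (f m) => [|[]].
  by move=> k km; apply: ltm; exact: ltnW.
by rewrite -yn /= fy.
Qed.

(** Evaluation that always ends: the result y + 1 stands for the output y, and 0
    for no output, because an oracle answer was missing or a minimization did
    not succeed below the bound s.  Oracle answers [O m] use the same coding, so
    that O can be a finite part of an oracle. *)
Fixpoint run (O : nat -> nat) (s : nat) (c : code) (x : seq nat) : nat :=
  match c with
  | Zero => 1
  | Succ => (head 0 x).+2
  | Proj i => (nth 0 x i).+1
  | Oracle => O (head 0 x)
  | Comp f gs =>
      let z := [seq run O s g x | g <- gs] in
      if all (leq 1) z then run O s f (map predn z) else 0
  | Prec f g =>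
      nat_rect (fun=> nat) (run O s f (behead x))
        (fun k v => if v == 0 then 0 else run O s g [:: k, v.-1 & behead x])
        (head 0 x)
  | Mu f => (search (fun k => run O s f (k :: x)) s).-1
  end.

Lemma run_sound (O : nat -> nat) s (A : set nat) c :
    (forall m v, O m = v.+1 -> v = char A m) ->
  forall x y, run O s c x = y.+1 -> eval A c x y.
Proof.
move=> OA; elim/code_nested_ind: c => /=.
- by move=> x y [<-].
- by move=> x y [<-].
- by move=> i x y [<-].
- by move=> x y /OA.
- move=> f gs IHf IHgs x y; case: ifP => // gx /IHf fx.
  exists (map predn [seq run O s g x | g <- gs]) => //.
  elim: gs IHgs gx {fx} => [|g gs IH] /=; first by constructor.
  move=> /List.Forall_cons_iff[Pg Pgs] /andP[g0 gs0].
  constructor; first by apply: Pg; rewrite prednK.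
  exact: IH.
- move=> f g IHf IHg x y.
  set w := nat_rect _ _ _ => wy.
  (* Once a value is missing, all later ones are, so the final one shows that
     no value is missing. *)
  have wk k d : 0 < w (k + d) -> 0 < w k.
    elim: d => [|d IH]; rewrite ?addn0 // addnS /= => wd; apply: IH.
    by case: (w (k + d)) wd.
  have w0 k : k <= head 0 x -> 0 < w k.
    by move=> kx; apply: (wk _ (head 0 x - k)); rewrite subnKC// wy.
  exists (predn \o w); split=> [|k kx|] /=.
  + by apply: IHf; have := w0 _ (leq0n _); rewrite /w /=; case: run.
  + have := w0 _ kx; have := w0 _ (ltnW kx) => /=.
    case: eqP => [->//|_ _ wS]; apply: IHg.
    by rewrite prednK.
  + by rewrite wy.
- move=> f IHf x y; case E : search => [|[|z]] //= [<-].
  have [fz fk] := searchS E; split; first exact: IHf.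
  move=> k /fk; case F : run => [|[|v]] // _; exists v; exact: IHf.
Qed.

(** A number s that bounds both the use and the searches of the computation.
    The quantification over all larger bounds and all extensions of the finite
    oracle builds monotonicity into the notion. *)
Definition halts_within A s c x y := forall O s', s <= s' ->
  (forall m, m < s -> O m = (char A m).+1) -> run O s' c x = y.+1.

Lemma halts_withinS A s t c x y : s <= t ->
  halts_within A s c x y -> halts_within A t c x y.
Proof.
move=> st h O s' ts OA; apply: h (leq_trans st ts) _ => m ms.
by apply: OA; exact: leq_trans st.
Qed.

Lemma bounded_choice (R : nat -> nat -> Prop) n :
    (forall k s t, s <= t -> R k s -> R k t) ->
    (forall k, k < n -> exists s, R k s) ->
  exists s, forall k, k < n -> R k s.
Proof.
move=> mono; elim: n => [|n IH] Rn; first by exists 0.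
have [|s sP] := IH; first by move=> k kn; apply: Rn; exact: ltnW.
have [t tP] := Rn n (leqnn _).
exists (maxn s t) => k; rewrite ltnS leq_eqVlt => /predU1P[->|/sP].
  exact: mono (leq_maxr _ _) tP.
exact: mono (leq_maxl _ _).
Qed.

(** The use principle: a halting computation asks finitely many questions. *)
Lemma run_complete A c x y : eval A c x y -> exists s, halts_within A s c x y.
Proof.
elim/code_nested_ind: c x y => /=.
- by move=> x y ->; exists 0.
- by move=> x y ->; exists 0.
- by move=> i x y ->; exists 0.
- by move=> x y ->; exists (head 0 x).+1 => O s' _ /= ->.
- move=> f gs IHf IHgs x y [z gz /IHf[s fs]].
  suff [t tP] : exists t, forall O s', t <= s' ->
      (forall m, m < t -> O m = (char A m).+1) ->
      [seq run O s' g x | g <- gs] = map succn z.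
    exists (maxn s t) => O s'; rewrite geq_max => /andP[ss ts] OA /=.
    rewrite tP//; last by move=> m mt; rewrite OA// leq_max mt orbT.
    rewrite all_map (eq_all (a2 := predT)) // all_predT -map_comp map_id.
    by apply: fs => // m ms; rewrite OA// leq_max ms.
  elim: gs IHgs z gz {fs} => [|g gs IH] /=.
    by move=> _ z gz; inversion gz; exists 0.
  move=> /List.Forall_cons_iff[Pg Pgs] [|v z] gz; inversion gz; subst.
  have [t tP] := IH Pgs _ H4; have [u uP] := Pg _ _ H2.
  exists (maxn t u) => O s'; rewrite geq_max => /andP[ts us] OA.
  rewrite uP ?tP// => m mt; by rewrite OA// leq_max mt ?orbT.
- move=> f g IHf IHg x y [w [/IHf[s fs] gw ->]].
  have [|t tP] := @bounded_choice
    (fun k t => halts_within A t g [:: k, w k & behead x] (w k.+1))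
    (head 0 x) _ (fun k kx => IHg _ _ (gw k kx)).
    by move=> k t u tu; exact: halts_withinS.
  exists (maxn s t) => O s'; rewrite geq_max => /andP[ss ts] OA /=.
  have As : forall m, m < s -> O m = (char A m).+1.
    by move=> m ms; rewrite OA// leq_max ms.
  have At : forall m, m < t -> O m = (char A m).+1.
    by move=> m ms; rewrite OA// leq_max ms orbT.
  elim: (head 0 x) tP {gw} => [|n IH] tP /=; first exact: fs.
  rewrite IH /=; last by move=> k kn; apply: tP; exact: ltnW.
  exact: tP.
- move=> f IHf x y [/IHf[s fs] fk].
  have [||t tP] := @bounded_choice
    (fun k t => exists v, halts_within A t f (k :: x) v.+1) y.
  + by move=> k t u tu [v vP]; exists v; exact: halts_withinS vP.
  + by move=> k /fk[v /IHf[t tP]]; exists t, v.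
  exists (maxn (maxn s t) y.+1) => O s'; rewrite !geq_max.
  move=> /andP[/andP[ss ts] ys] OA /=.
  rewrite (@search_complete _ _ y)//.
    by apply: fs => // m ms; rewrite OA// !leq_max ms.
  move=> k /tP[v ->] // m ms; by rewrite OA// !leq_max ms orbT.
Qed.

(** Two computations from one oracle can be run within a common bound, and [run]
    is a function. *)
Lemma eval_det A c x y z : eval A c x y -> eval A c x z -> y = z.
Proof.
move=> /run_complete[s sP] /run_complete[t tP].
have := sP (fun m => (char A m).+1) _ (leq_maxl s t) (fun _ _ => erefl).
by rewrite tP ?leq_maxr// => -[].
Qed.

(** Any injection into the numbers serves; the first entry of each list tells
    the constructors apart. *)
Fixpoint code_number (c : code) : nat :=
  CodeSeq.code match c with
  | Zero => [:: 0]
  | Succ => [:: 1]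
  | Proj i => [:: 2; i]
  | Oracle => [:: 3]
  | Comp f gs => [:: 4, code_number f & map code_number gs]
  | Prec f g => [:: 5; code_number f; code_number g]
  | Mu f => [:: 6; code_number f]
  end.

Lemma code_number_inj : injective code_number.
Proof.
have codeI := can_inj CodeSeq.codeK.
elim/code_nested_ind => [||i||f gs IHf IHgs|f g IHf IHg|f IHf];
  case=> [||i'||f' gs'|f' g'|f'] /codeI //.
- by case=> ->.
- case=> /IHf -> gsE; congr Comp.
  elim: gs gs' IHgs gsE => [|g gs IH] [|g' gs'] //=.
  by move=> /List.Forall_cons_iff[Ig Igs] [/Ig-> /IH->].
- by case=> /IHf -> /IHg ->.
- by case=> /IHf ->.
Qed.

Lemma code_enumeration : exists u : nat -> code, forall c, exists n, u n = c.
Proof.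
have /choice[u uP] : forall n, exists c,
    (exists d, code_number d = n) -> code_number c = n.
  move=> n; have [[d <-]|nd] := pselect (exists d, code_number d = n).
    by exists d.
  by exists Zero => /nd.
exists u => c; exists (code_number c); apply: code_number_inj; apply: uP.
by exists c.
Qed.

(** * Recursive functions on tuples of fixed length *)

(** Total functions of k arguments, computed without an oracle.  The arity is
    part of the notion because the outer program of a composition receives a
    fixed number of arguments. *)
Definition recursive (k : nat) (f : seq nat -> nat) : Prop :=
  exists2 c, oracle_free c & forall x, size x = k -> eval set0 c x (f x).

(** Lists of m recursive functions, in the form in which they are fed to a
    function of m arguments. *)
Definition recursive_seq (k m : nat) (g : seq nat -> seq nat) : Prop :=
  exists2 cs, all oracle_free cs & forall x, size x = k ->
    size (g x) = m /\
    List.Forall2 (fun (r : seq nat -> nat -> Prop) v => r x v)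
      (map (eval set0) cs) (g x).

Lemma eq_recursive k f g : (forall x, size x = k -> f x = g x) ->
  recursive k f -> recursive k g.
Proof.
by move=> fg [c c0 cP]; exists c => // x xk; rewrite -fg//; exact: cP.
Qed.

Lemma recursive_nth k i : recursive k (fun x => nth 0 x i).
Proof. by exists (Proj i). Qed.

Lemma recursive_comp k m f g :
  recursive_seq k m g -> recursive m f -> recursive k (fun x => f (g x)).
Proof.
move=> [cs cs0 csP] [c c0 cP]; exists (Comp c cs) => /=; first by rewrite c0.
by move=> x /csP[gx Fx]; exists (g x) => //; exact: cP.
Qed.

Lemma recursive_nil k : recursive_seq k 0 (fun=> [::]).
Proof. by exists [::]. Qed.

Lemma recursive_cons k m f g : recursive k f -> recursive_seq k m g ->
  recursive_seq k m.+1 (fun x => f x :: g x).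
Proof.
move=> [c c0 cP] [cs cs0 csP]; exists (c :: cs) => /=; first by rewrite c0.
move=> x xk; have [gx Fx] := csP _ xk; split; first by rewrite gx.
by constructor => //; exact: cP.
Qed.

Lemma recursive_drop d k : recursive_seq (d + k) k (drop d).
Proof.
exists [seq Proj i | i <- iota d k]; first by rewrite all_map; exact/allP.
move=> x xk; rewrite size_drop xk addKn; split=> //.
have -> : drop d x = [seq nth 0 x i | i <- iota d k].
  rewrite map_nth_iota ?size_drop ?xk ?addKn//.
  by rewrite take_oversize// size_drop xk addKn.
by elim: (iota d k) => /=; constructor.
Qed.

Lemma recursive_const k n : recursive k (fun=> n).
Proof.
elim: n => [|n [c c0 cP]]; first by exists Zero.
exists (Comp Succ [:: c]) => /=; first by rewrite c0.
by move=> x /cP nx; exists [:: n] => //; constructor; [exact: nx|constructor].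
Qed.

Lemma recursive_succ k f : recursive k f -> recursive k (fun x => (f x).+1).
Proof.
move=> [c c0 cP]; exists (Comp Succ [:: c]) => /=; first by rewrite c0.
by move=> x /cP fx; exists [:: f x] => //; constructor; [exact: fx|constructor].
Qed.

(** Primitive recursion where the step may use all arguments, and any
    recursive function r serves as the number of steps.  Here, as in all lemmas
    below on bounded operations, a bound variable becomes the first entry of
    the argument list. *)
Lemma recursive_iter k f g r : recursive k f ->
    recursive k.+2 (fun y => g (nth 0 y 0) (nth 0 y 1) (drop 2 y)) ->
    recursive k r ->
  recursive k (fun x =>
    nat_rect (fun=> nat) (f x) (fun i v => g i v x) (r x)).
Proof.
move=> [cf cf0 cfP] [cg cg0 cgP] rr.
apply: (@recursive_comp _ k.+1
  (fun y => nat_rect (fun=> nat) (f (behead y))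
              (fun i v => g i v (behead y)) (head 0 y)) (fun x => r x :: x)).
  apply: recursive_cons => //.
  rewrite (_ : (fun x => x) = drop 0); first exact: (recursive_drop 0 k).
  by apply/funext => x; rewrite drop0.
exists (Prec cf cg) => /=; first by rewrite cf0.
move=> [//|n x] [xk] /=.
exists (nat_rect (fun=> nat) (f x) (fun i v => g i v x)); split=> //=.
  exact: cfP.
move=> i _; have := cgP (_ :: _ :: x); rewrite /= drop0; apply.
by rewrite xk.
Qed.


Lemma recursive_add k f g : recursive k f -> recursive k g ->
  recursive k (fun x => f x + g x).
Proof.
move=> rf rg; apply: (@eq_recursive _ (fun x =>
    nat_rect (fun=> nat) (g x) (fun i v => v.+1) (f x))).
  by move=> x _; elim: (f x) => //= n ->.
by apply: recursive_iter => //; apply: recursive_succ; exact: recursive_nth.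
Qed.

Lemma recursive_pred k f : recursive k f -> recursive k (fun x => (f x).-1).
Proof.
move=> rf; apply: (@eq_recursive _ (fun x =>
    nat_rect (fun=> nat) 0 (fun i v => i) (f x))).
  by move=> x _; case: (f x).
by apply: recursive_iter => //; [exact: recursive_const|exact: recursive_nth].
Qed.

Lemma recursive_sub k f g : recursive k f -> recursive k g ->
  recursive k (fun x => f x - g x).
Proof.
move=> rf rg; apply: (@eq_recursive _ (fun x =>
    nat_rect (fun=> nat) (f x) (fun i v => v.-1) (g x))).
  by move=> x _; elim: (g x) => /= [|n ->]; rewrite ?subn0 ?subnS.
by apply: recursive_iter => //; apply: recursive_pred; exact: recursive_nth.
Qed.

Lemma recursive_behead k f : recursive k f ->
  recursive k.+1 (fun y => f (behead y)).
Proof.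
move=> rf; apply: recursive_comp rf.
rewrite (_ : behead = drop 1); first exact: (recursive_drop 1).
by apply/funext => x; rewrite drop1.
Qed.

Lemma recursive_drop2 k f : recursive k f ->
  recursive k.+2 (fun y => f (drop 2 y)).
Proof. by apply: recursive_comp; exact: (recursive_drop 2). Qed.

Lemma recursive_mul k f g : recursive k f -> recursive k g ->
  recursive k (fun x => f x * g x).
Proof.
move=> rf rg; apply: (@eq_recursive _ (fun x =>
    nat_rect (fun=> nat) 0 (fun i v => g x + v) (f x))).
  by move=> x _; elim: (f x) => /= [|n ->]; rewrite ?mul0n ?mulSn.
apply: recursive_iter => //; first exact: recursive_const.
by apply: recursive_add; [exact: recursive_drop2|exact: recursive_nth].
Qed.

Lemma recursive_pow2 k f : recursive k f -> recursive k (fun x => 2 ^ f x).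
Proof.
move=> rf; apply: (@eq_recursive _ (fun x =>
    nat_rect (fun=> nat) 1 (fun i v => v + v) (f x))).
  by move=> x _; elim: (f x) => //= n ->; rewrite expnS mul2n addnn.
apply: recursive_iter => //; first exact: recursive_const.
by apply: recursive_add; exact: recursive_nth.
Qed.

Lemma recursive_leq k f g : recursive k f -> recursive k g ->
  recursive k (fun x => (f x <= g x)%N : nat).
Proof.
move=> rf rg; apply: (@eq_recursive _ (fun x => 1 - (f x - g x))).
  by move=> x _; rewrite -subn_eq0; case: (f x - g x).
by apply: recursive_sub; [exact: recursive_const|exact: recursive_sub].
Qed.

Lemma recursive_and k (b c : seq nat -> bool) :
  recursive k (fun x => b x : nat) -> recursive k (fun x => c x : nat) ->
  recursive k (fun x => b x && c x : nat).
Proof.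
move=> rb rc; apply: eq_recursive (recursive_mul rb rc) => x _.
by rewrite mulnb.
Qed.

Lemma recursive_neg k (b : seq nat -> bool) :
  recursive k (fun x => b x : nat) -> recursive k (fun x => ~~ b x : nat).
Proof.
move=> rb; apply: eq_recursive (recursive_sub (recursive_const k 1) rb) => x _.
by case: (b x).
Qed.

Lemma recursive_or k (b c : seq nat -> bool) :
  recursive k (fun x => b x : nat) -> recursive k (fun x => c x : nat) ->
  recursive k (fun x => b x || c x : nat).
Proof.
move=> rb rc.
apply: (eq_recursive _
  (recursive_neg (recursive_and (recursive_neg rb) (recursive_neg rc)))) => x _.
by rewrite negb_and !negbK.
Qed.

Lemma recursive_imp k (b c : seq nat -> bool) :
  recursive k (fun x => b x : nat) -> recursive k (fun x => c x : nat) ->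
  recursive k (fun x => b x ==> c x : nat).
Proof.
move=> rb rc; apply: eq_recursive (recursive_or (recursive_neg rb) rc) => x _.
by rewrite implybE.
Qed.

Lemma recursive_eq k f g : recursive k f -> recursive k g ->
  recursive k (fun x => (f x == g x) : nat).
Proof.
move=> rf rg; apply: (eq_recursive _
  (recursive_and (recursive_leq rf rg) (recursive_leq rg rf))) => x _.
by rewrite eqn_leq.
Qed.

Lemma recursive_if k (b : seq nat -> bool) f g :
  recursive k (fun x => b x : nat) -> recursive k f -> recursive k g ->
  recursive k (fun x => if b x then f x else g x).
Proof.
move=> rb rf rg; apply: (eq_recursive _ (recursive_add
  (recursive_mul rb rf) (recursive_mul (recursive_neg rb) rg))) => x _.
by case: (b x); rewrite ?mul1n ?mul0n ?addn0.
Qed.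

(** Counting over an initial segment of the numbers gives the bounded
    quantifiers as special cases. *)
Lemma recursive_count k (p : nat -> seq nat -> bool) r :
    recursive k r ->
    recursive k.+1 (fun y => p (nth 0 y 0) (behead y) : nat) ->
  recursive k (fun x => count (fun i => p i x) (iota 0 (r x))).
Proof.
move=> rr rp; apply: (@eq_recursive _ (fun x =>
    nat_rect (fun=> nat) 0 (fun i v => p i x + v) (r x))).
  move=> x _; elim: (r x) => // n IH; rewrite [LHS]/= IH.
  by rewrite -[in RHS]addn1 iotaD count_cat /= add0n addn0 addnC.
apply: recursive_iter => //; first exact: recursive_const.
apply: recursive_add; last exact: recursive_nth.
apply: (recursive_comp (g := fun y => nth 0 y 0 :: drop 2 y) _ rp).
by apply: recursive_cons; [exact: recursive_nth|exact: (recursive_drop 2)].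
Qed.

Lemma recursive_all k (p : nat -> seq nat -> bool) r :
    recursive k r ->
    recursive k.+1 (fun y => p (nth 0 y 0) (behead y) : nat) ->
  recursive k (fun x => all (fun i => p i x) (iota 0 (r x)) : nat).
Proof.
move=> rr rp; apply: (eq_recursive _ (recursive_eq (recursive_count rr rp) rr)).
by move=> x _; rewrite all_count size_iota.
Qed.

Lemma recursive_has k (p : nat -> seq nat -> bool) r :
    recursive k r ->
    recursive k.+1 (fun y => p (nth 0 y 0) (behead y) : nat) ->
  recursive k (fun x => has (fun i => p i x) (iota 0 (r x)) : nat).
Proof.
move=> rr rp; apply: (eq_recursive _
  (recursive_leq (recursive_const k 1) (recursive_count rr rp))).
by move=> x _; rewrite has_count.
Qed.

Lemma recursive_search k (f : nat -> seq nat -> nat) r :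
    recursive k r ->
    recursive k.+1 (fun y => f (nth 0 y 0) (behead y)) ->
  recursive k (fun x => search (fun i => f i x) (r x)).
Proof.
move=> rr rf; apply: recursive_iter => //; first exact: recursive_const.
have rf2 : recursive k.+2 (fun y => f (nth 0 y 0) (drop 2 y)).
  apply: (recursive_comp (g := fun y => nth 0 y 0 :: drop 2 y) _ rf).
  by apply: recursive_cons; [exact: recursive_nth|exact: (recursive_drop 2)].
have rn i m := recursive_nth i m; have rc i m := recursive_const i m.
apply: recursive_if; [exact: recursive_eq| |exact: rn].
apply: recursive_if; [exact: recursive_eq|exact: rc|].
apply: recursive_if; [exact: recursive_eq| |exact: rc].
by do 2 apply: recursive_succ; exact: rn.
Qed.

(** Finite sets of numbers are represented by binary expansions. *)
Definition bit (e m : nat) : bool := odd (iter m half e).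

Lemma recursive_odd k f : recursive k f ->
  recursive k (fun x => odd (f x) : nat).
Proof.
move=> rf; apply: (@eq_recursive _ (fun x =>
    nat_rect (fun=> nat) 0 (fun i v => 1 - v) (f x))).
  by move=> x _; elim: (f x) => //= n ->; case: odd.
apply: recursive_iter => //; first exact: recursive_const.
by apply: recursive_sub; [exact: recursive_const|exact: recursive_nth].
Qed.

Lemma recursive_half k f : recursive k f -> recursive k (fun x => (f x)./2).
Proof.
move=> rf; apply: (@eq_recursive _ (fun x =>
    nat_rect (fun=> nat) 0 (fun i v => odd i + v) (f x))).
  by move=> x _; elim: (f x) => //= n ->; rewrite uphalf_half.
apply: recursive_iter => //; first exact: recursive_const.
by apply: recursive_add; [apply: recursive_odd|]; exact: recursive_nth.
Qed.

Lemma recursive_bit k f g : recursive k f -> recursive k g ->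
  recursive k (fun x => bit (f x) (g x) : nat).
Proof.
move=> rf rg; apply: recursive_odd; apply: (@eq_recursive _ (fun x =>
    nat_rect (fun=> nat) (f x) (fun i v => v./2) (g x))).
  by move=> x _; elim: (g x) => //= n ->.
by apply: recursive_iter => //; apply: recursive_half; exact: recursive_nth.
Qed.

Lemma bit_surj K (A : pred nat) :
  exists2 e, e < 2 ^ K & forall m, m < K -> bit e m = A m.
Proof.
elim: K A => [|K IH] A; first by exists 0.
have [e eK eA] := IH (A \o succn); exists (A 0 + e.*2).
  by rewrite expnS; case: (A 0); lia.
move=> [_|m mK]; rewrite /bit; first by rewrite /= oddD odd_double oddb addbF.
by rewrite iterSr half_bit_double; exact: eA.
Qed.

(** The finite oracle that knows the part of A below s. *)
Definition query (s : nat) (A : pred nat) (m : nat) : nat :=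
  if m < s then (A m).+1 else 0.

(** A program c is compiled, by induction on c, into a program without oracle
    that gets the bound s and the number e of a finite oracle as two additional
    arguments. *)
Lemma recursive_run c k : recursive k.+2
  (fun y => run (query (nth 0 y 0) (bit (nth 0 y 1))) (nth 0 y 0) c (drop 2 y)).
Proof.
have rn i m := recursive_nth i m; have rc i m := recursive_const i m.
pose sim c k := recursive k.+2
  (fun y => run (query (nth 0 y 0) (bit (nth 0 y 1))) (nth 0 y 0) c (drop 2 y)).
have call c' m n (s e : seq nat -> nat) a : sim c' n ->
    recursive m s -> recursive m e -> recursive_seq m n a ->
    recursive m (fun y => run (query (s y) (bit (e y))) (s y) c' (a y)).
  move=> rc' rs re ra.
  have : recursive_seq m n.+2 (fun y => [:: s y, e y & a y]).
    by do 2 apply: recursive_cons => //.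
  by move=> /recursive_comp/(_ rc') /=; under eq_fun do rewrite drop0.
rewrite -/(sim c k).
elim/code_nested_ind: c k => [||i||f gs IHf IHgs|f g IHf IHg|f IHf] k.
- exact: rc.
- rewrite /sim /=; under eq_fun do rewrite -nth0 nth_drop.
  by do 2 apply: recursive_succ; exact: rn.
- rewrite /sim /=; under eq_fun do rewrite nth_drop.
  by apply: recursive_succ; exact: rn.
- rewrite /sim /= /query; under eq_fun do rewrite -nth0 nth_drop.
  apply: recursive_if => //.
    by apply: recursive_leq => //; exact: recursive_succ.
  by apply: recursive_succ; exact: recursive_bit.
- rewrite /sim /=.
  apply: recursive_if => //.
    elim: gs IHgs => [|g gs IH] /=; first by move=> _; exact: rc.
    move=> /List.Forall_cons_iff[Ig Igs]; apply: recursive_and; last exact: IH.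
    by apply: recursive_leq => //; exact: Ig.
  apply: (call _ _ (size gs)) => //.
  elim: gs IHgs => [|g gs IH] /=; first by move=> _; exact: recursive_nil.
  move=> /List.Forall_cons_iff[Ig Igs]; apply: recursive_cons; last exact: IH.
  by apply: recursive_pred; exact: Ig.
- case: k => [|k]; rewrite /sim /=.
    (* The absent recursion argument counts as 0. *)
    apply: eq_recursive (IHf 0) => y; case: y => [|s [|e []]] //.
  apply: recursive_iter.
  + apply: (call _ _ k) => //.
    under eq_fun do rewrite -drop1 drop_drop; exact: (recursive_drop 3).
  + apply: recursive_if => //; first by apply: recursive_eq.
    under eq_fun do rewrite -drop1 !drop_drop !nth_drop.
    apply: (call _ _ k.+2) => //; do 2?[apply: recursive_cons] => //.
      exact: recursive_pred.
    exact: (recursive_drop 5).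
  + by under eq_fun do rewrite -nth0 nth_drop; exact: rn.
- rewrite /sim /=; apply: recursive_pred; apply: recursive_search => //.
  under eq_fun do rewrite !nth_behead -drop1 drop_drop.
  apply: (call _ _ k.+1) => //; apply: recursive_cons => //.
  exact: (recursive_drop 3).
Qed.

Lemma recursive_run_query c k m s e g :
    recursive k s -> recursive k e -> recursive_seq k m g ->
  recursive k (fun x => run (query (s x) (bit (e x))) (s x) c (g x)).
Proof.
move=> rs re rg.
have : recursive_seq k m.+2 (fun y => [:: s y, e y & g y]).
  by do 2 apply: recursive_cons => //.
move=> /recursive_comp/(_ (recursive_run c m)) /=.
by under eq_fun do rewrite drop0.
Qed.

(** * Densities in binary trees *)

(** Closure under initial segments; it suffices to remove one bit. *)
Definition subtree (Q : pred (seq bool)) : Prop :=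
  forall s b, Q (rcons s b) -> Q s.

Lemma subtree_cat Q s t : subtree Q -> Q (s ++ t) -> Q s.
Proof.
move=> tQ; elim/last_ind: t => [|t b IH]; first by rewrite cats0.
by rewrite -rcons_cat => /tQ.
Qed.

Fixpoint num_ext (Q : pred (seq bool)) (s : seq bool) (n : nat) : nat :=
  if n is m.+1 then
    num_ext Q (rcons s false) m + num_ext Q (rcons s true) m
  else Q s.

Lemma num_ext_le Q s n : num_ext Q s n <= 2 ^ n.
Proof.
elim: n s => [|n IH] s /=; first by case: (Q s).
by rewrite expnS mul2n -addnn leq_add.
Qed.

Lemma eq_num_ext Q Q' s n :
    (forall t, size t = n -> Q (s ++ t) = Q' (s ++ t)) ->
  num_ext Q s n = num_ext Q' s n.
Proof.
elim: n s => [|n IH] s QQ' /=; first by have := QQ' [::]; rewrite cats0 => ->.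
by congr (_ + _); apply: IH => t tn; rewrite cat_rcons; apply: QQ';
  rewrite /= tn.
Qed.

(** Inclusion and exclusion. *)
Lemma num_ext_meet Q Q' s n :
  num_ext Q s n + num_ext Q' s n <= 2 ^ n + num_ext (predI Q Q') s n.
Proof.
elim: n s => [|n IH] s /=; first by case: (Q s); case: (Q' s).
by have := IH (rcons s false); have := IH (rcons s true); rewrite expnS; lia.
Qed.

(** The proportion of extensions in a tree decreases with their length, so that
    its infimum over all lengths is its limit, the relative measure above s. *)
Lemma num_extS Q s n : subtree Q -> num_ext Q s n.+1 <= 2 * num_ext Q s n.
Proof.
move=> tQ; elim: n s => [|n IH] s.
  have /= := tQ s; case: (Q s) => h; first by do 2 case: (Q _).
  by rewrite !(negbTE (contraFN (h _) _)).
by have := IH (rcons s false); have := IH (rcons s true) => /=; lia.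
Qed.

(** The set of paths of Q has relative measure at least a / b above s, when Q is
    a tree. *)
Definition density_ge (a b : nat) (Q : pred (seq bool)) (s : seq bool) : Prop :=
  forall n, a * 2 ^ n <= b * num_ext Q s n.

(** Positive measure above s, when Q is a tree. *)
Definition fat (Q : pred (seq bool)) (s : seq bool) : Prop :=
  exists b, density_ge 1 b Q s.

Lemma fat_mem Q s : fat Q s -> Q s.
Proof. by move=> [b /(_ 0)] /=; case: (Q s) => //; rewrite muln0. Qed.

Lemma sparse_mono a b Q s n m : subtree Q -> n <= m ->
  b * num_ext Q s n < a * 2 ^ n -> b * num_ext Q s m < a * 2 ^ m.
Proof.
move=> tQ /subnK <- sn; elim: (m - n) => // d IH.
rewrite addSn expnS -/(num_ext Q s (d + n).+1).
by have := num_extS s (d + n) tQ; nia.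
Qed.

(** Several failures of density can be witnessed at a common length. *)
Lemma eventually_sparse a b Q s : subtree Q -> ~ density_ge a b Q s ->
  exists n, forall m, n <= m -> b * num_ext Q s m < a * 2 ^ m.
Proof.
move=> tQ /existsNP[n /negP]; rewrite -ltnNge => sn; exists n => m nm.
exact: sparse_mono nm sn.
Qed.

(** The density above s is the mean of the densities above its two children. *)
Lemma dense_child a b Q s : subtree Q -> density_ge a b Q s ->
  exists c, density_ge a b Q (rcons s c).
Proof.
move=> tQ sd; apply: contrapT => /forallNP nd.
have [n nP] := eventually_sparse tQ (nd false).
have [m mP] := eventually_sparse tQ (nd true).
have := nP _ (leq_maxl n m); have := mP _ (leq_maxr n m).
by have := sd (maxn n m).+1; rewrite /= expnS; nia.
Qed.

Lemma fat_child Q s : subtree Q -> fat Q s -> exists c, fat Q (rcons s c).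
Proof. by move=> tQ [b /(dense_child tQ)[c ?]]; exists c, b. Qed.

Lemma fat_parent Q s c : subtree Q -> fat Q (rcons s c) -> fat Q s.
Proof.
move=> tQ bc; have Qs := tQ _ _ (fat_mem bc); move: bc => [b cb].
exists (b * 2) => -[|n]; first by have := cb 0; rewrite /= Qs; case: b {cb}.
have := cb n; rewrite /= expnS.
by case: c {cb}; nia.
Qed.

Lemma dense_extension a b Q s n : subtree Q -> density_ge a b Q s ->
  exists2 t, size t = n & density_ge a b Q (s ++ t).
Proof.
move=> tQ sd; elim: n => [|n [t tn /(dense_child tQ)[c cd]]].
  by exists [::]; rewrite // cats0.
by exists (rcons t c); rewrite ?size_rcons ?tn// -rcons_cat.
Qed.

(** The sibling contributes at most 1/2 to the density above s. *)
Lemma three_quarters_child Q s c :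
  density_ge 3 4 Q s -> density_ge 1 2 Q (rcons s c).
Proof.
move=> sd n; have := sd n.+1; rewrite /= expnS.
have := num_ext_le Q (rcons s false) n.
have := num_ext_le Q (rcons s true) n.
by case: c; lia.
Qed.

Lemma dense_meet Q Q' s :
  density_ge 3 4 Q s -> density_ge 1 2 Q' s -> density_ge 1 4 (predI Q Q') s.
Proof.
move=> sd sd' n; have := sd n; have := sd' n; have := num_ext_meet Q Q' s n.
by lia.
Qed.

Lemma pow43_unbounded b : exists k, b * 3 ^ k < 4 ^ k.
Proof.
exists (3 * b).
(* Bernoulli: (4/3)^k is at least 1 + k/3, here for k = 3b. *)
suff : (3 * b + 3) * 3 ^ (3 * b) <= 3 * 4 ^ (3 * b).
  have : 0 < 3 ^ (3 * b) by rewrite expn_gt0.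
  by nia.
by elim: (3 * b) => // k IH; rewrite !expnS; nia.
Qed.

(** The Lebesgue density theorem for trees.  If the density were less than 3/4
    above all extensions of s, then the proportion of extensions of s in Q would
    be multiplied by at most 3/4 again and again when passing to suitable longer
    lengths, and hence tend to 0. *)
Lemma dense_in_fat Q s : subtree Q -> fat Q s ->
  exists t, density_ge 3 4 Q (s ++ t).
Proof.
move=> tQ [b sb]; apply: contrapT => /forallNP nd.
have thin n : exists m, 4 * num_ext Q s (n + m) <= 3 * 2 ^ m * num_ext Q s n.
  suff [m mP] : exists m, forall m', m <= m' ->
      4 * num_ext Q s (n + m') <= 3 * 2 ^ m' * num_ext Q s n.
    by exists m; exact: mP.
  elim: n s nd {sb} => [|n IH] s nd.
    case Qs : (Q s).
      have := nd [::]; rewrite cats0 => /(eventually_sparse tQ)[m mP].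
      by exists m => m' /mP /ltnW; rewrite add0n /= Qs muln1.
    exists 0 => m' _; rewrite add0n.
    suff -> : num_ext Q s m' = 0 by [].
    elim: m' => [|m' IH]; first by rewrite /= Qs.
    apply/eqP; rewrite -leqn0; apply: leq_trans (num_extS s m' tQ) _.
    by rewrite IH.
  have ndc c t : ~ density_ge 3 4 Q (rcons s c ++ t).
    by rewrite cat_rcons; exact: nd.
  have [[m mP] [m' m'P]] := (IH _ (ndc false), IH _ (ndc true)).
  exists (maxn m m') => k; rewrite geq_max addSn /= => /andP[/mP + /m'P].
  by lia.
(* Apply [thin] k times, starting from length 0. *)
have iterate k : exists n, 4 ^ k * num_ext Q s n <= 3 ^ k * 2 ^ n.
  elim: k => [|k [n nP]]; first by exists 0; rewrite !mul1n num_ext_le.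
  have [m mP] := thin n; exists (n + m); rewrite !expnS expnD.
  have := leq_mul (leqnn (4 ^ k)) mP; have := leq_mul (leqnn (3 * 2 ^ m)) nP.
  by lia.
have [k bk] := pow43_unbounded b; have [n nk] := iterate k.
have := leq_mul (leqnn (4 ^ k)) (sb n); have := leq_mul (leqnn b) nk.
have : 0 < 2 ^ n by rewrite expn_gt0.
by nia.
Qed.

Definition fat_part (Q : pred (seq bool)) : pred (seq bool) :=
  fun s => `[<fat Q s>].

(** Strings outside [fat_part Q] carry no measure of Q, so together they cost no
    more than the slack of 1/4 when the length is large enough. *)
Lemma dense_fat_part Q s : subtree Q ->
  density_ge 3 4 Q s -> density_ge 1 2 (fat_part Q) s.
Proof.
move=> tQ sd n.
suff [m mP] : exists m, forall m', m <= m' ->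
    4 * num_ext Q s (n + m') <=
    4 * 2 ^ m' * num_ext (fat_part Q) s n + 2 ^ n * 2 ^ m'.
  have := mP _ (leqnn m); have := sd (n + m); rewrite expnD.
  have : 0 < 2 ^ m by rewrite expn_gt0.
  by nia.
elim: n s {sd} => [|n IH] s.
  rewrite /= /fat_part; case: asboolP => bs.
    exists 0 => m _; rewrite add0n; have := num_ext_le Q s m; lia.
  have [|m mP] := @eventually_sparse 1 4 Q s tQ.
    by move=> ?; apply: bs; exists 4.
  by exists m => m' /mP; rewrite add0n; lia.
have [[m mP] [m' m'P]] := (IH (rcons s false), IH (rcons s true)).
exists (maxn m m') => k; rewrite geq_max addSn /= expnS => /andP[/mP + /m'P].
by lia.
Qed.

(** Below level h, the set is closed under initial segments and has no dead
    ends; one equation says both. *)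
Definition pruned (h : nat) (Q : pred (seq bool)) : Prop :=
  forall s, size s < h -> Q s = Q (rcons s false) || Q (rcons s true).

Lemma fat_part_subtree Q : subtree Q -> subtree (fat_part Q).
Proof. by move=> tQ s b /asboolP/(fat_parent tQ)/asboolP. Qed.

Lemma fat_part_pruned h Q : subtree Q -> pruned h (fat_part Q).
Proof.
move=> tQ s _; apply/idP/orP => [/asboolP/(fat_child tQ)[[] ?]|].
- by right; apply/asboolP.
- by left; apply/asboolP.
- by move=> [] /fat_part_subtree; exact.
Qed.

Lemma pruned_parent h Q s b : pruned h Q -> size s < h -> Q (rcons s b) -> Q s.
Proof. by move=> pQ /pQ ->; case: b => ->; rewrite ?orbT. Qed.

Lemma pruned_prefix h Q s t :
  pruned h Q -> size (s ++ t) <= h -> Q (s ++ t) -> Q s.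
Proof.
move=> pQ; elim/last_ind: t => [|t b IH]; first by rewrite cats0.
rewrite -rcons_cat size_rcons => th /(pruned_parent pQ th).
by apply: IH; exact: ltnW.
Qed.

Lemma pruned_extend h Q s n : pruned h Q -> size s + n <= h -> Q s ->
  exists2 t, size t = n & Q (s ++ t).
Proof.
move=> pQ + Qs; elim: n => [|n IH] sn; first by exists [::]; rewrite // cats0.
have [|t tn] := IH; first by rewrite (leq_trans _ sn)// leq_add2l.
rewrite pQ => [/orP[] Qt|]; last by rewrite size_cat tn -addnS.
  by exists (rcons t false); rewrite ?size_rcons ?tn// -rcons_cat.
by exists (rcons t true); rewrite ?size_rcons ?tn// -rcons_cat.
Qed.

(** A string of length at most h is in a pruned tree if and only if it has an
    extension of length h there. *)
Lemma eq_pruned h Q Q' : pruned h Q -> pruned h Q' ->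
    (forall s, size s = h -> Q s = Q' s) ->
  forall s, size s <= h -> Q s = Q' s.
Proof.
move=> pQ pQ' eqh s; move dE : (h - size s) => d.
elim: d s dE => [|d IH] s dE sh; first by apply: eqh; lia.
have sh' : size s < h by lia.
rewrite (pQ s sh') (pQ' s sh').
by congr (_ || _); apply: IH; rewrite ?size_rcons; lia.
Qed.

(** * The forcing relation on numbered finite trees *)

Lemma string_code_rcons s b :
  string_code (rcons s b) = (string_code s).*2 + b.+1.
Proof. by rewrite /string_code foldl_rcons. Qed.

Lemma string_code_bounds s :
  2 ^ size s <= (string_code s).+1 < 2 ^ (size s).+1.
Proof.
elim/last_ind: s => // s b; rewrite string_code_rcons size_rcons !expnS.
by case: b; lia.
Qed.

Lemma string_code_surj m : exists s, string_code s = m.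
Proof.
have [n] := ubnP m; elim: n m => // n IH [|m] mn; first by exists [::].
have [|s sE] := IH m./2; first by lia.
exists (rcons s (odd m)); rewrite string_code_rcons sE.
by have := odd_double_half m; case: odd; lia.
Qed.

Lemma string_code_inj : injective string_code.
Proof.
elim/last_ind=> [|s b IH] t; elim/last_ind: t => [|t c _] //;
  rewrite ?string_code_rcons; try (rewrite /string_code /=; lia).
case: b; case: c => E; try lia.
- by congr rcons; apply: IH; lia.
- by congr rcons; apply: IH; lia.
Qed.

Lemma string_code_lt s h : (string_code s < (2 ^ h).-1) = (size s < h).
Proof.
have /andP[lo hi] := string_code_bounds s.
have h0 : 0 < 2 ^ h by rewrite expn_gt0.
apply/idP/idP => [sh|/(leq_pexp2l (isT : 0 < 2))]; last by lia.
by rewrite -(@ltn_exp2l 2)//; lia.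
Qed.

Lemma size_le_string_code s : size s <= string_code s.
Proof.
have /andP[+ _] := string_code_bounds s.
by have := ltn_expl (size s) (isT : 1 < 2); lia.
Qed.

Definition strings (A : pred nat) : pred (seq bool) :=
  fun s => A (string_code s).

Definition prunedb (h : nat) (A : pred nat) : bool :=
  all (fun m => A m == A m.*2.+1 || A m.*2.+2) (iota 0 (2 ^ h).-1).

Lemma prunedP h A : reflect (pruned h (strings A)) (prunedb h A).
Proof.
apply: (iffP allP) => [pA s sh|pA m].
  have := pA (string_code s); rewrite mem_iota /= add0n string_code_lt.
  by move=> /(_ sh)/eqP; rewrite /strings !string_code_rcons addn1 addn2.
have [s <-] := string_code_surj m; rewrite mem_iota /= add0n string_code_lt.
move=> /pA; rewrite /strings !string_code_rcons addn1 addn2 => ->.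
exact: eqxx.
Qed.

Lemma count_iotaD p a b :
  count p (iota 0 (a + b)) =
  count p (iota 0 a) + count (fun r => p (a + r)) (iota 0 b).
Proof.
rewrite iotaD count_cat add0n; congr (_ + _).
by rewrite -[X in iota X](addn0 a) iotaDl count_map.
Qed.

(** The numbers of the extensions of s by n bits form an interval; adding 1 to
    all numbers makes extension by a bit b the map sending k to 2k + b. *)
Lemma num_ext_strings A s n :
  num_ext (strings A) s n =
  count (fun r => A ((string_code s).+1 * 2 ^ n + r).-1) (iota 0 (2 ^ n)).
Proof.
elim: n s => [|n IH] s /=; first by rewrite muln1 addn0 /= addn0.
rewrite !IH !string_code_rcons expnS mul2n -(addnn (2 ^ n)) count_iotaD.
by congr (_ + _); apply: eq_count => r; congr (A _); lia.
Qed.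

Section Forcing.
Variables (c : code) (h : nat).
Implicit Types (V S : pred (seq bool)) (A : pred nat).

Definition half_dense V n S : Prop :=
  pruned (h + n) S /\
  forall s, size s = h -> V s -> 2 ^ n <= 2 * num_ext S s n.

(** S' is a possible finite approximation to the tree under construction: it
    has exactly the leaves V on level h, and further growth inside S. *)
Definition thins V n S S' : Prop :=
  [/\ pruned (h + n) S', forall s, size s = h -> S' s = V s
    & forall s, size s <= h + n -> S' s -> S s].

(** Only strings of length at most h + n matter here, so that quantifying over
    all sets A amounts to quantifying over finite ones; but this form keeps the
    numbers of finite sets out of the forcing argument.  As the bound in [run]
    is h + n, the oracle is only asked about strings of smaller length. *)
Definition forces V n x v : Prop :=
  forall A, half_dense V n (strings A) ->
  exists2 A', thins V n (strings A) (strings A')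
    & run (query (h + n) A') (h + n) c [:: x] = v.+1.

(** Transfers a bounded quantifier over numbers to strings of length h. *)
Lemma all_level (p : pred nat) :
  all p [seq m + (2 ^ h).-1 | m <- iota 0 (2 ^ h)] <->
  forall s, size s = h -> p (string_code s).
Proof.
have h0 : 0 < 2 ^ h by rewrite expn_gt0.
split=> [/allP ap s sh|ps].
  apply: ap; apply/mapP; exists (string_code s - (2 ^ h).-1).
    by rewrite mem_iota; have := string_code_bounds s; rewrite sh expnS; lia.
  by have := string_code_bounds s; rewrite sh expnS; lia.
apply/allP => k /mapP[m]; rewrite mem_iota => mh ->{k}.
have [s sE] := string_code_surj (m + (2 ^ h).-1).
rewrite -sE; apply: ps; apply/eqP; rewrite eqn_leq -ltnS -!string_code_lt.
rewrite [h <= _]leqNgt -string_code_lt sE expnS.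
by lia.
Qed.

Definition half_denseb e0 n e : bool :=
  prunedb (h + n) (bit e) &&
  all (fun m => bit e0 (m + (2 ^ h).-1) ==>
    (2 ^ n <= 2 * count (fun r => bit e ((m + (2 ^ h).-1).+1 * 2 ^ n + r).-1)
                    (iota 0 (2 ^ n))))
    (iota 0 (2 ^ h)).

Lemma half_denseP e0 n e :
  half_denseb e0 n e <-> half_dense (strings (bit e0)) n (strings (bit e)).
Proof.
rewrite /half_denseb /half_dense; split=> [/andP[/prunedP pe]|[pe] he].
  have := (all_level (fun m => bit e0 m ==>
    (2 ^ n <= 2 * count (fun r => bit e (m.+1 * 2 ^ n + r).-1)
                    (iota 0 (2 ^ n))))).
  rewrite all_map => -[+ _] => /[apply] he; split=> // s sh /(implyP (he _ sh)).
  by rewrite num_ext_strings.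
apply/andP; split; first exact/prunedP.
have := (all_level (fun m => bit e0 m ==>
  (2 ^ n <= 2 * count (fun r => bit e (m.+1 * 2 ^ n + r).-1)
                  (iota 0 (2 ^ n))))).
rewrite all_map => -[_ +]; apply=> s sh; apply/implyP => /(he _ sh).
by rewrite num_ext_strings.
Qed.

Definition thinsb e0 n e e' : bool :=
  [&& prunedb (h + n) (bit e'),
      all (fun m => bit e' (m + (2 ^ h).-1) == bit e0 (m + (2 ^ h).-1))
        (iota 0 (2 ^ h))
    & all (fun m => bit e' m ==> bit e m) (iota 0 (2 ^ (h + n).+1).-1)].

Lemma thinsP e0 n e e' : thinsb e0 n e e' <->
  thins (strings (bit e0)) n (strings (bit e)) (strings (bit e')).
Proof.
have lvl := all_level (fun m => bit e' m == bit e0 m).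
rewrite all_map in lvl.
split=> [/and3P[/prunedP pe /lvl he /allP sub]|[pe he sub]].
  split=> // [s sh|s sh]; first exact/eqP/he.
  by apply/implyP/sub; rewrite mem_iota add0n /= string_code_lt.
apply/and3P; split; first exact/prunedP.
  by apply/lvl => s sh; apply/eqP; exact: he.
apply/allP => m; have [s <-] := string_code_surj m.
by rewrite mem_iota add0n /= string_code_lt => /sub/implyP.
Qed.

Definition forcesb e0 n x v : bool :=
  all (fun e => half_denseb e0 n e ==>
    has (fun e' => thinsb e0 n e e' &&
           (run (query (h + n) (bit e')) (h + n) c [:: x] == v.+1))
      (iota 0 (2 ^ (2 ^ (h + n).+1))))
    (iota 0 (2 ^ (2 ^ (h + n).+1))).

(** Each set of strings agrees with a numbered finite one on all that is
    relevant to [forces] with n new levels. *)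
Lemma strings_truncate n A : exists2 e, e < 2 ^ (2 ^ (h + n).+1) &
  (forall s, size s <= h + n -> strings (bit e) s = strings A s) /\
  query (h + n) (bit e) = query (h + n) A.
Proof.
have [e eK eA] := bit_surj (2 ^ (h + n).+1) A; exists e => //; split.
  move=> s; rewrite -ltnS -string_code_lt => sn; apply: eA.
  by apply: leq_trans sn _; exact: leq_pred.
apply/funext => m; rewrite /query; case: ifP => // mn; rewrite eA//.
by apply: ltn_trans mn (ltn_trans (ltnSn _) _); exact: ltn_expl.
Qed.

Lemma pruned_ext S S' n : (forall s, size s <= n -> S s = S' s) ->
  pruned n S -> pruned n S'.
Proof.
by move=> SS' pS s sn; rewrite -!SS' ?size_rcons ?(ltnW sn)//; exact: pS.
Qed.

(** The two quantifiers over sets in [forces] may be restricted to finite sets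
    whose numbers are below a bound. *)
Lemma forcesP e0 n x v : forcesb e0 n x v <-> forces (strings (bit e0)) n x v.
Proof.
split=> [/allP fb A [pA hA]|f].
  have [e eK [eA _]] := strings_truncate n A.
  have he : half_denseb e0 n e.
    apply/half_denseP; split=> [|s sh Vs].
      by apply: pruned_ext pA => s sn; rewrite eA.
    rewrite (@eq_num_ext _ (strings A)); first exact: hA.
    by move=> t tn; rewrite eA// size_cat sh tn.
  have := implyP (fb e _) he; rewrite mem_iota => /(_ eK)/hasP[e' _].
  move=> /andP[/thinsP[pe' he' sub] /eqP re'].
  exists (bit e') => //; split=> // s sn /(sub s sn); by rewrite eA.
apply/allP => e _; apply/implyP => /half_denseP/f[A' [pA' hA' sub] rA'].
have [e' eK [eA qA]] := strings_truncate n A'.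
apply/hasP; exists e'; first by rewrite mem_iota.
rewrite qA rA' eqxx andbT; apply/thinsP; split=> [|s sh|s sn].
- by apply: pruned_ext pA' => s sn; rewrite eA.
- by rewrite eA ?sh ?leq_addr// hA'.
- by rewrite eA//; exact: sub.
Qed.

End Forcing.

(** * The forcing relation is decidable *)

Lemma recursive_eqb k (b c : seq nat -> bool) :
  recursive k (fun x => b x : nat) -> recursive k (fun x => c x : nat) ->
  recursive k (fun x => (b x == c x) : nat).
Proof.
move=> rb rc; apply: eq_recursive (recursive_eq rb rc) => x _.
by case: (b x); case: (c x).
Qed.

Lemma recursive_prunedb k f g : recursive k f -> recursive k g ->
  recursive k (fun x => prunedb (f x) (bit (g x)) : nat).
Proof.
move=> rf rg; apply: recursive_all.
  by apply: recursive_pred; exact: recursive_pow2.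
have rh := recursive_behead rg; have rm := recursive_nth k.+1 0.
have rdbl : recursive k.+1 (fun y => (nth 0 y 0).*2).
  by under eq_fun do rewrite -addnn; exact: recursive_add.
apply: recursive_eqb; first exact: recursive_bit.
by apply: recursive_or; apply: recursive_bit => //; do !apply: recursive_succ.
Qed.

Lemma recursive_half_denseb h e0 k f g : recursive k f -> recursive k g ->
  recursive k (fun x => half_denseb h e0 (f x) (g x) : nat).
Proof.
move=> rf rg; have rc i m := recursive_const i m.
apply: recursive_and.
  by apply: recursive_prunedb => //; exact: recursive_add.
apply: recursive_all => //.
have rm := recursive_nth k.+1 0.
apply: recursive_imp; first by apply: recursive_bit => //; exact: recursive_add.
have rfb := recursive_behead rf; have rgb := recursive_behead rg.
apply: recursive_leq; first exact: recursive_pow2.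
apply: recursive_mul => //; apply: recursive_count; first exact: recursive_pow2.
apply: recursive_bit; first exact: recursive_behead rgb.
apply: recursive_pred; apply: recursive_add; last exact: recursive_nth.
apply: recursive_mul; last first.
  by apply: recursive_pow2; exact: recursive_behead rfb.
apply: recursive_succ; apply: recursive_add => //.
exact: recursive_behead rm.
Qed.

Lemma recursive_thinsb h e0 k f g g' :
    recursive k f -> recursive k g -> recursive k g' ->
  recursive k (fun x => thinsb h e0 (f x) (g x) (g' x) : nat).
Proof.
move=> rf rg rg'; have rc i m := recursive_const i m.
have rm := recursive_nth k.+1 0.
apply: recursive_and.
  by apply: recursive_prunedb => //; exact: recursive_add.
apply: recursive_and.
  apply: recursive_all => //; apply: recursive_eqb.
    by apply: recursive_bit; [exact: recursive_behead rg'|exact: recursive_add].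
  by apply: recursive_bit => //; exact: recursive_add.
apply: recursive_all.
  apply: recursive_pred; apply: recursive_pow2; apply: recursive_succ.
  exact: recursive_add.
apply: recursive_imp; apply: recursive_bit => //.
  exact: recursive_behead rg'.
exact: recursive_behead rg.
Qed.

Lemma recursive_forcesb c h e0 v k f g : recursive k f -> recursive k g ->
  recursive k (fun x => forcesb c h e0 (f x) (g x) v : nat).
Proof.
move=> rf rg; have rc i m := recursive_const i m.
have masks i (f' : seq nat -> nat) : recursive i f' ->
    recursive i (fun x => 2 ^ (2 ^ (h + f' x).+1)).
  move=> rf'; do 2 apply: recursive_pow2.
  by apply: recursive_succ; exact: recursive_add.
apply: recursive_all; first exact: masks.
have rf1 := recursive_behead rf; have rg1 := recursive_behead rg.
apply: recursive_imp.
  by apply: recursive_half_denseb => //; exact: recursive_nth.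
apply: recursive_has; first exact: masks.
have rf2 := recursive_behead rf1; have rg2 := recursive_behead rg1.
apply: recursive_and.
  apply: recursive_thinsb => //; last exact: recursive_nth.
  by apply: (recursive_behead (f := fun y => nth 0 y 0)); exact: recursive_nth.
apply: recursive_eq => //; apply: (@recursive_run_query _ _ 1).
- exact: recursive_add.
- exact: recursive_nth.
- by apply: recursive_cons => //; exact: recursive_nil.
Qed.

(** Search for the least n that decides the value at x; then evaluate again at
    this n. *)
Lemma computable_of_recursive X (d : nat -> nat -> bool -> bool) :
    (forall v, recursive 2 (fun y => d (nth 0 y 0) (nth 0 y 1) v : nat)) ->
    (forall x, exists n, d n x `[< X x >]) ->
    (forall n x v, d n x v -> v = `[< X x >]) ->
  computable X.
Proof.
move=> rd total sound.
have [f f0 fP] : recursive 2 (fun y =>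
    ~~ (d (nth 0 y 0) (nth 0 y 1) true ||
        d (nth 0 y 0) (nth 0 y 1) false) : nat).
  by apply: recursive_neg; exact: recursive_or.
have [g g0 gP] := rd true.
exists (Comp g [:: Mu f; Proj 0]) => /=; first by rewrite g0 f0.
move=> x; have ex : exists n, d n x true || d n x false.
  by have [n] := total x; case: `[< X x >] => nP; exists n; rewrite nP ?orbT.
case: (ex_minnP ex) => n nP minn.
have -> : char X x = d n x true.
  rewrite /char; case/orP: nP => dn; rewrite -(sound _ _ _ dn) ?dn//.
  by case E : (d n x true) => //; rewrite (sound _ _ _ E) -(sound _ _ _ dn).
exists [:: n; x]; last exact: gP.
constructor; last by constructor.
split=> [|k kn]; first by have := fP [:: n; x] erefl; rewrite /= nP.
exists 0; have := fP [:: k; x] erefl => /=; case E : (_ || _) => //.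
by move: (minn _ E); rewrite leqNgt kn.
Qed.

Lemma strings_surj (V : pred (seq bool)) : exists A, strings A = V.
Proof.
exists (fun m => `[< exists2 s, string_code s = m & V s >]); apply/funext => s.
apply/asboolP/idP => [[t /string_code_inj->]//|Vs]; by exists s.
Qed.

Lemma eq_forces c h V V' n x v : (forall s, size s = h -> V s = V' s) ->
  forces c h V n x v -> forces c h V' n x v.
Proof.
move=> VV' f A [pA hA].
have [|A' [pA' eA' sub] rA'] := f A.
  by split=> // s sh; rewrite VV'//; exact: hA.
by exists A' => //; split=> // s sh; rewrite eA' ?VV'.
Qed.

Lemma computable_of_forces X c h V :
    (forall x, exists n, forces c h V n x (char X x)) ->
    (forall n x (v : bool), forces c h V n x v -> v = `[< X x >]) ->
  computable X.
Proof.
have [A <-{V}] := strings_surj V => total sound.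
have [e _ [eA _]] := strings_truncate h 0 A.
have forcesA n x v : forces c h (strings A) n x v <-> forcesb c h e n x v.
  split=> [f|/forcesP]; last by apply: eq_forces => s sh; rewrite eA ?addn0 ?sh.
  by apply/forcesP; apply: eq_forces f => s sh; rewrite eA ?addn0 ?sh.
apply: (@computable_of_recursive _ (fun n x v => forcesb c h e n x v)).
- by move=> v; apply: recursive_forcesb; exact: recursive_nth.
- by move=> x; have [n /forcesA] := total x; exists n.
- by move=> n x v /forcesA/sound.
Qed.

(** * Cantor space and its measure *)

Lemma nbhs_agree (f : cantor_space) n :
  nbhs f [set g : cantor_space | forall m, m < n -> g m = f m].
Proof.
elim: n => [|n IH]; first by apply: filterS filterT => g _ m.
have fn : nbhs f [set g : cantor_space | g n = f n].
  exact: (@proj_continuous nat (fun=> bool) n f _ (discrete_set1 (f n))).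
apply: filterS (filterI IH fn) => g [gf gn] m.
by rewrite ltnS leq_eqVlt => /predU1P[->|/gf].
Qed.

(** Otherwise there are points outside U agreeing with f on longer and longer
    initial segments, and they converge to f pointwise. *)
Lemma nbhs_agreeP (f : cantor_space) (U : set cantor_space) : nbhs f U ->
  exists n, forall g : cantor_space, (forall m, m < n -> g m = f m) -> U g.
Proof.
move=> fU; apply: contrapT => /forallNP nU.
have /choice[g gP] : forall n, exists g : cantor_space,
    (forall m, m < n -> g m = f m) /\ ~ U g.
  by move=> n; have /existsNP[g /not_implyP[gf gU]] := nU n; exists g.
have gf : {ptws, g @ \oo --> (f : nat -> bool)}.
  apply/pointwise_cvgP => t A /nbhs_singleton At.
  by exists t.+1 => // n /= tn; rewrite /= (gP n).1.
have [n _ /(_ n (leqnn n))] := gf _ fU.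
exact: (gP n).2.
Qed.

(** Compactness of Cantor space: A is a cluster point of the sequence. *)
Lemma limit_of_predicates (A_ : nat -> pred nat) :
  exists A : pred nat, forall K, exists n,
    K <= n /\ forall m, m < K -> A m = A_ n m.
Proof.
pose f : nat -> cantor_space := A_.
have [A [_ clA]] := @cantor_space_compact (f @ \oo) _ filterT.
exists A => K; have tail : (f @ \oo) (f @` [set n | K <= n]).
  by exists K => // n /= Kn; exists n.
have [_ [[n Kn <-] nA]] := clA _ _ tail (nbhs_agree A K).
by exists n; split=> // m /nA.
Qed.

Lemma eq_initial_segment (f g : cantor_space) n :
  (forall m, m < n -> f m = g m) -> initial_segment f n = initial_segment g n.
Proof.
by move=> fg; apply/eq_in_map => m; rewrite mem_iota => /andP[_ /fg].
Qed.

Section Perfect.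
Variable P : pred (seq bool).
Hypotheses (P0 : P [::]) (Ppruned : forall h, pruned h P).
Hypothesis Psplit : forall s, P s -> exists t u,
  [/\ size t = size u, t != u, P (s ++ t) & P (s ++ u)].

(** Prolong s forever, taking the right child whenever it is in P. *)
Lemma path_through s : P s -> exists2 f : cantor_space,
  (forall n, P (initial_segment f n)) & initial_segment f (size s) = s.
Proof.
move=> Ps; pose next t := P (rcons t true).
pose grow n := iter n (fun t => rcons t (next t)) s.
have sz n : size (grow n) = size s + n.
  by elim: n => [|n IH]; rewrite ?addn0// size_rcons IH addnS.
have Pgrow n : P (grow n).
  elim: n => //= n IH; rewrite -/(grow n) /next.
  case nt : (P (rcons (grow n) true)) => //.
  have pg : pruned (size (grow n)).+1 P by [].
  by have := pg _ (ltnSn _); rewrite IH nt orbF => <-.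
pose f : cantor_space := fun m => nth false (grow m.+1) m.
have pre n m : prefix (grow n) (grow (n + m)).
  elim: m => [|m IH]; first by rewrite addn0 prefix_refl.
  by rewrite addnS; apply: prefix_trans IH _; exact: prefix_rcons.
have fE n m : m < size (grow n) -> nth false (grow n) m = f m.
  move=> mn; rewrite /f.
  have [/subnKC <-|/ltnW/subnKC <-] := leqP n m.+1.
    by have /prefixP[t ->] := pre n (m.+1 - n); rewrite nth_cat mn.
  have /prefixP[t ->] := pre m.+1 (n - m.+1); rewrite nth_cat sz.
  by have -> : m < size s + m.+1 by rewrite addnS ltnS leq_addl.
have init n : initial_segment f (size (grow n)) = grow n.
  apply: (@eq_from_nth _ false); rewrite size_mkseq// => i ig.
  by rewrite nth_mkseq// fE.
exists f; last exact: (init 0).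
move=> n; have ng : n <= size (grow n) by rewrite sz leq_addl.
have := Pgrow n; rewrite -init -(subnKC ng).
rewrite /initial_segment /mkseq iotaD map_cat.
apply: (@pruned_prefix (size (grow n))) => //.
by rewrite size_cat !size_map !size_iota subnKC.
Qed.

(** The perfect set consists of all paths.  Through each initial segment of a
    path f go two different paths, and at least one of them is not f. *)
Lemma perfect_tree_of_splitting : perfect_tree [set s | P s].
Proof.
pose C : set cantor_space := [set f | forall n, P (initial_segment f n)].
exists C; split.
- by have [f fP _] := path_through P0; exists f.
- split.
    move=> f clf n; have [g [Cg gf]] := clf _ (nbhs_agree f n).
    by rewrite -(eq_initial_segment gf); exact: Cg.
  apply/seteqP; split=> f.
    move=> lf n; have [g [_ Cg gf]] := lf _ (nbhs_agree f n).
    by rewrite -(eq_initial_segment gf); exact: Cg.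
  move=> Cf U /nbhs_agreeP[n nU].
  have [t [u [tu tNu Pt Pu]]] := Psplit (Cf n).
  have [g Cg gE] := path_through Pt; have [g' Cg' gE'] := path_through Pu.
  have agree (k : cantor_space) v :
      initial_segment k (size (initial_segment f n ++ v)) =
        initial_segment f n ++ v ->
      forall m, m < n -> k m = f m.
    move=> kE m mn.
    have szn : size (initial_segment f n) = n by rewrite size_mkseq.
    have := congr1 (fun w => nth false w m) kE.
    rewrite nth_mkseq; last by rewrite size_cat szn ltn_addr.
    by rewrite nth_cat szn mn nth_mkseq.
  have [gf|gf] := pselect (g = f); last first.
    by exists g; split=> //; [exact/eqP|apply: nU; exact: agree gE].
  exists g'; split=> //; last by apply: nU; exact: agree gE'.
  apply/eqP => g'f; move/eqP: tNu; apply; apply/eqP.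
  move: gE gE'; rewrite gf g'f !size_cat tu => -> /eqP.
  by rewrite eqseq_cat// => /andP[].
- apply/seteqP; split=> s /=.
    by move=> /path_through[f Cf fs]; exists f, (size s).
  by move=> [f [n [Cf ->]]]; exact: Cf.
Qed.

End Perfect.

Lemma extension_list Q s n : exists L, [/\ size L = num_ext Q s n,
  forall t, t \in L -> size t = size s + n
  & forall t, size t = n -> Q (s ++ t) -> s ++ t \in L].
Proof.
elim: n s => [|n IH] s.
  exists (nseq (Q s) s); split; first by rewrite size_nseq.
    by move=> t; rewrite mem_nseq => /andP[_ /eqP->]; rewrite addn0.
  by case=> // _; rewrite cats0 => Qs; rewrite mem_nseq Qs eqxx.
have [L0 [s0 z0 m0]] := IH (rcons s false).
have [L1 [s1 z1 m1]] := IH (rcons s true).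
exists (L0 ++ L1); split; first by rewrite size_cat s0 s1.
  by move=> t; rewrite mem_cat => /orP[/z0|/z1] ->; rewrite size_rcons addSnnS.
by move=> [|[] t] //= [tn]; rewrite -cat_rcons mem_cat => Qt;
  rewrite ?m0 ?m1 ?orbT.
Qed.

Section CantorMeasure.

Import Order.TTheory GRing.Theory Num.Theory.
Local Open Scope ring_scope.

(** The mass of a cover by N strings of length n, prolonged to an infinite one
    by strings of lengths k + i + 1. *)
Lemma padded_sum (R : realType) (n N k m : nat) (a : nat -> R) :
    (forall i, (i < N)%N -> a i = 2 ^- n) ->
    (forall i, (N <= i)%N -> a i = 2 ^- (k + i).+1) ->
  \sum_(0 <= i < m) a i <= (minn m N)%:R * 2 ^- n + 2 ^- k - 2 ^- (k + m).
Proof.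
move=> aN ak; have half i : 2 ^- i = 2 ^- i.+1 + 2 ^- i.+1 :> R.
  have : (2 ^+ i : R) != 0 by rewrite expf_neq0// pnatr_eq0.
  by rewrite exprS; move: (2 ^+ i) => x x0; field.
elim: m => [|m IH]; first by rewrite big_nil min0n mul0r addn0 add0r subrr.
rewrite big_nat_recr //=; apply: le_trans (lerD IH (lexx _)) _.
rewrite addnS (half (k + m)%N).
have p0 : 0 <= 2 ^- (k + m).+1 :> R by rewrite invr_ge0 exprn_ge0.
case: (ltnP m N) => mN.
  rewrite aN// (minn_idPl mN) -(natr1 m) mulrDl mul1r.
  by lra.
by rewrite ak// (minn_idPr (leqW mN)); lra.
Qed.

(** Cover the paths by the strings of length n in T.  The definition of the
    measure asks for infinite covers, so superfluous cylinders of total mass at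
    most 2^-k are added. *)
Lemma cantor_measure_le (R : realType) (T : set (seq bool)) n k :
    (2 ^ k * num_ext (fun s => `[< T s >]) [::] n <= 2 ^ n)%N ->
  (cantor_measure R (paths T) <= (2 ^- k + 2 ^- k)%:E)%E.
Proof.
move=> few; have [L [sL zL mL]] := extension_list (fun s => `[< T s >]) [::] n.
pose s i := nth (nseq (k + i).+1 false) L i.
apply: ge_ereal_inf; exists (\sum_(i <oo) (2 ^- size (s i))%:E)%E.
  exists s => // f Tf; have : initial_segment f n \in L.
    apply: (mL (initial_segment f n)); first by rewrite size_mkseq.
    by apply/asboolP; exact: Tf.
  move=> fL; exists (index (initial_segment f n) L) => //.
  by rewrite /s /cylinder /= nth_index// /initial_segment size_mkseq.
apply: lime_le.
  by apply: is_cvg_nneseries => i _ _; rewrite lee_fin invr_ge0 exprn_ge0.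
apply: nearW => m; rewrite sumEFin lee_fin.
apply: le_trans (@padded_sum R n (size L) k m _ _ _) _.
- by move=> i iL; rewrite /s zL// mem_nth.
- by move=> i iL; rewrite /s nth_default// size_nseq.
have p0 : 0 <= 2 ^- (k + m) :> R by rewrite invr_ge0 exprn_ge0.
suff : (minn m (size L))%:R * 2 ^- n <= 2 ^- k :> R by lra.
apply: (@le_trans _ _ ((size L)%:R * 2 ^- n)).
  by rewrite ler_wpM2r ?invr_ge0 ?exprn_ge0// ler_nat geq_minr.
rewrite ler_pdivrMr ?exprn_gt0// mulrC ler_pdivlMr ?exprn_gt0//.
by rewrite -!natrX -natrM ler_nat sL mulnC.
Qed.

(** Otherwise T contains, for every k, less than a fraction 2^-k of the strings
    of some length, and these strings cover all paths. *)
Lemma fat_root (R : realType) (T : set (seq bool)) :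
    subtree (fun s => `[< T s >]) ->
    (0 < cantor_measure R (paths T))%E ->
  fat (fun s => `[< T s >]) [::].
Proof.
move=> tT mT; apply: contrapT => nb.
have small k : (cantor_measure R (paths T) <= (2 ^- k + 2 ^- k)%:E)%E.
  have [|n nP] := @eventually_sparse 1 (2 ^ k) _ [::] tT.
    by move=> d; apply: nb; exists (2 ^ k)%N.
  apply: (@cantor_measure_le _ _ n); apply: ltnW.
  by have := nP _ (leqnn n); rewrite mul1n.
suff : (cantor_measure R (paths T) <= 0)%E by rewrite leNgt mT.
apply/lee_addgt0Pr => e e0; rewrite add0e.
have e20 : 0 < e / 2 by rewrite divr_gt0.
have [k _ /(_ k (leqnn k)) /= ke] := near_infty_natSinv_expn_lt (PosNum e20).
apply: le_trans (small k) _; rewrite lee_fin.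
by move: ke; rewrite div1r /=; lra.
Qed.

End CantorMeasure.

(** * Forcing with a finite tree and a reservoir *)

(** A forcing condition. *)
Record stage := Stage {
  level : nat;
  leaves : pred (seq bool);
  reservoir : pred (seq bool) }.

Definition valid (p : stage) : Prop :=
  [/\ subtree (reservoir p), exists s, leaves p s
    & forall s, leaves p s -> size s = level p /\ fat (reservoir p) s].

(** Here q is the stronger condition; each leaf of p must survive, since in the
    end all leaves are to belong to P. *)
Definition extends (p q : stage) : Prop :=
  [/\ level p <= level q, forall s, reservoir q s -> reservoir p s,
      forall s, leaves q s -> leaves p (take (level p) s)
    & forall s, leaves p s -> exists t, leaves q (s ++ t)].

Definition dense_leaves (p : stage) : Prop :=
  forall s, leaves p s -> density_ge 3 4 (reservoir p) s.

(** The possible values of P according to the condition p. *)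
Definition compatible (P : pred (seq bool)) (p : stage) : Prop :=
  [/\ forall h, pruned h P, forall s, P s -> reservoir p s
    & forall s, size s = level p -> P s = leaves p s].

Lemma extends_refl p : valid p -> extends p p.
Proof.
move=> [_ _ pz]; split=> // [s|s] ps; last by exists [::]; rewrite cats0.
by have [sz _] := pz _ ps; rewrite -sz take_size.
Qed.

Lemma extends_trans q p r : extends p q -> extends q r -> extends p r.
Proof.
move=> [lpq Rpq tpq epq] [lqr Rqr tqr eqr]; split.
- exact: leq_trans lqr.
- by move=> s /Rqr/Rpq.
- by move=> s /tqr/tpq; rewrite take_takel.
- by move=> s /epq[t /eqr[u]]; rewrite -catA => ?; exists (t ++ u).
Qed.

(** The lengths needed to reach high density differ from leaf to leaf, but by
    [dense_extension] high density persists to some extension of any larger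
    length.  So all strings of high density of a common length above the old
    leaves can serve as the new leaves. *)
Lemma dense_step p : valid p -> exists q,
  [/\ valid q, extends p q & dense_leaves q].
Proof.
move=> [tQ [s0 ps0] pz]; have [h0 _] := pz _ ps0.
pose dense_at k N := forall s, string_code s = k -> leaves p s ->
  forall m, N <= m ->
  exists2 t, size t = m & density_ge 3 4 (reservoir p) (s ++ t).
have [||N NP] := @bounded_choice dense_at (2 ^ (level p).+1).-1.
- by move=> k a b ab ka s sk ps m bm; apply: ka => //; exact: leq_trans bm.
- move=> k _; have [s sk] := string_code_surj k.
  have [ps|nps] := pselect (leaves p s); last first.
    by exists 0 => t tk; rewrite (@string_code_inj t s)// tk sk.
  have [t td] := dense_in_fat tQ (pz _ ps).2.
  exists (size t) => u uk _ m tm; rewrite (@string_code_inj u s) ?uk ?sk//.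
  have [v vm vd] := @dense_extension _ _ _ _ (m - size t) tQ td.
  by exists (t ++ v); rewrite ?size_cat ?vm ?subnKC// catA.
have extend s : leaves p s ->
    exists2 t, size t = N & density_ge 3 4 (reservoir p) (s ++ t).
  move=> ps; have [sz _] := pz _ ps; apply: (NP (string_code s)) => //.
  by rewrite string_code_lt sz.
exists (Stage (level p + N)
  (fun u => [&& size u == level p + N, leaves p (take (level p) u)
              & `[< density_ge 3 4 (reservoir p) u >]]) (reservoir p)).
have newleaf s t : leaves p s -> size t = N ->
    density_ge 3 4 (reservoir p) (s ++ t) ->
    [&& size (s ++ t) == level p + N, leaves p (take (level p) (s ++ t))
      & `[< density_ge 3 4 (reservoir p) (s ++ t) >]].
  move=> ps tN d; have [sz _] := pz _ ps.
  rewrite size_cat sz tN eqxx /= -sz take_size_cat// ps /=; exact/asboolP.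
split; last by move=> s /= /and3P[_ _ /asboolP].
- split=> //=.
    by have [t tN td] := extend _ ps0; exists (s0 ++ t); exact: newleaf.
  move=> s /and3P[/eqP sz _ /asboolP sd]; split=> //; exists 4 => n.
  by have := sd n; lia.
- split=> //=; first exact: leq_addr.
  + by move=> s /and3P[].
  + by move=> s ps; have [t tN td] := extend _ ps; exists t; exact: newleaf.
Qed.

Definition splits (p q : stage) : Prop :=
  level p < level q /\ forall s, leaves p s -> exists t u,
    [/\ size t = size u, t != u, leaves q (s ++ t) & leaves q (s ++ u)].

(** Above a leaf of density 3/4 both children keep density 1/2. *)
Lemma split_step p : valid p -> dense_leaves p -> exists q,
  [/\ valid q, extends p q & splits p q].
Proof.
move=> [tQ [s0 ps0] pz] pd.
exists (Stage (level p).+1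
  (fun u => (size u == (level p).+1) && leaves p (take (level p) u))
  (reservoir p)).
have newleaf s b : leaves p s ->
    (size (s ++ [:: b]) == (level p).+1) &&
    leaves p (take (level p) (s ++ [:: b])).
  move=> ps; have [sz _] := pz _ ps.
  by rewrite size_cat addn1 sz eqxx /= -sz take_size_cat.
split.
- split=> //=; first by exists (s0 ++ [:: true]); exact: newleaf.
  move=> s /andP[/eqP]; case/lastP: s => // s b; rewrite size_rcons => -[sz].
  rewrite -sz -cats1 take_size_cat// cats1 => ps; split=> //.
  by exists 2; apply: three_quarters_child; exact: pd.
- split=> //= [s /andP[]//|s ps]; by exists [:: true]; exact: newleaf.
- split=> //= s ps; exists [:: true], [:: false]; split=> //; exact: newleaf.
Qed.

Lemma image_string_code A :
  string_code @` [set s | strings A s] = [set m | A m].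
Proof.
apply/seteqP; split=> [_ [s As <-]//|m Am].
by have [s sm] := string_code_surj m; exists s => //=; rewrite /strings sm.
Qed.

Lemma charE (A : pred nat) m : char [set m | A m] m = A m.
Proof. by rewrite /char /=; case: asboolP; case: (A m). Qed.

Lemma pred_agree_on_strings A B n :
    (forall s, size s <= n -> strings A s = strings B s) ->
  forall m, m <= n -> A m = B m.
Proof.
move=> AB m; have [s <-] := string_code_surj m => sn; apply: AB.
exact: leq_trans (size_le_string_code s) sn.
Qed.

Section Decide.
Variables (X : set nat) (c : code).

Definition avoids (q : stage) : Prop := forall P, compatible P q ->
  exists x, ~ eval (string_code @` [set s | P s]) c [:: x] (char X x).

(** Apply the hypothesis to the strings above which the reservoir is fat, so
    that the new leaves are fat again.  On numbers below the bound, the tree P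
    gives the same oracle answers as the finite tree obtained. *)
Lemma avoid_by_extension p n x (v : bool) :
    valid p -> dense_leaves p -> forces c (level p) (leaves p) n x v ->
    v <> `[< X x >] ->
  exists q, [/\ valid q, extends p q & avoids q].
Proof.
move=> [tQ [s0 ps0] pz] pd pf vX.
have [A AE] := strings_surj (fat_part (reservoir p)).
have [|A' [pA' eA' sub] rA'] := pf A.
  rewrite AE; split; first exact: fat_part_pruned.
  by move=> s _ ps; have := dense_fat_part tQ (pd _ ps) n; rewrite mul1n.
rewrite AE in sub.
pose q := Stage (level p + n)
  (fun s => (size s == level p + n) && strings A' s) (reservoir p).
have extend s : leaves p s -> exists t, leaves q (s ++ t).
  move=> ps; have [sz _] := pz _ ps.
  have [||t tn At] := @pruned_extend _ _ s n pA'; rewrite ?sz// ?eA'//.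
  by exists t; rewrite /= size_cat sz tn eqxx.
exists q; split.
- split=> //; first by have [t] := extend _ ps0; exists (s0 ++ t).
  move=> s /andP[/eqP sz /sub]; rewrite sz => /(_ (leqnn _))/asboolP.
  by split.
- split=> //=; first exact: leq_addr.
  move=> s /andP[/eqP sz As].
  rewrite -eA'; last by rewrite size_takel ?sz ?leq_addr.
  apply: (pruned_prefix (t := drop (level p) s) pA');
    by rewrite cat_take_drop// sz.
- move=> P [pP _ eP]; have [B BE] := strings_surj P; exists x.
  rewrite -BE image_string_code => ev.
  have agree := @eq_pruned _ _ _ pA' (pP _).
  apply: vX; suff : eval [set m | B m] c [:: x] v.
    by move=> /(eval_det ev); rewrite /char; case: v {pf rA'}; case: asboolP.
  apply: run_sound rA' => m w; rewrite /query; case: ifP => // mn [<-].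
  rewrite charE; congr nat_of_bool.
  apply: (@pred_agree_on_strings _ _ (level p + n)); last exact: ltnW.
  by rewrite BE; apply: agree => s sz; rewrite eP//= sz eqxx.
Qed.

(** The new reservoir lies inside a limit of trees A_ n showing that X(x) is not
    forced.  If c computed X(x) from P, say with bound s, take n large such that
    A_ n agrees with the limit up to length [level p + s], and prolong P from
    this length on by all strings in A_ n.  The outcome would be a thinning of
    A_ n on which c outputs X(x). *)
Lemma avoid_by_thinning p x :
    valid p -> dense_leaves p ->
    (forall n, ~ forces c (level p) (leaves p) n x (char X x)) ->
  exists q, [/\ valid q, extends p q & avoids q].
Proof.
move=> [tQ [s0 ps0] pz] pd nf.
have /choice[A_ A_P] : forall n, exists A,
    half_dense (level p) (leaves p) n (strings A) /\
    forall A', thins (level p) (leaves p) n (strings A) (strings A') ->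
      run (query (level p + n) A') (level p + n) c [:: x] <> (char X x).+1.
  move=> n; have /existsNP[A /not_implyP[hA nA]] := nf n; exists A; split=> //.
  by move=> A' tA' rA'; apply: nA; exists A'.
have [A AP] := limit_of_predicates A_.
have lim h : exists n, h <= n /\
    forall s, size s <= h -> strings A s = strings (A_ n) s.
  have [n [hn nP]] := AP (2 ^ h.+1).-1; exists n; split.
    by have := ltn_expl h.+1 (isT : 1 < 2); lia.
  by move=> s sh; apply: nP; rewrite string_code_lt.
have subA : subtree (strings A).
  move=> s b; have [n [sn nP]] := lim (size s).+1.
  rewrite !nP ?size_rcons//; apply: pruned_parent (A_P n).1.1 _.
  by rewrite (leq_trans sn)// leq_addl.
have denseA s : leaves p s -> density_ge 1 2 (strings A) s.
  move=> ps m; have [sz _] := pz _ ps.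
  have [n [mn nP]] := lim (level p + m).
  have {}mn : m <= n by rewrite (leq_trans _ mn)// leq_addl.
  have [pA hA] := (A_P n).1.
  (* Density 1/2 is known for A_ n at length n only; it passes down to m since
     proportions decrease in a tree, such as A_ n cut off at its height. *)
  pose S t := (size t <= level p + n) && strings (A_ n) t.
  have tS : subtree S.
    move=> t b /andP[]; rewrite size_rcons => tn /(pruned_parent pA tn) At.
    by rewrite /S At andbT ltnW.
  have ES k : k <= n -> num_ext S s k = num_ext (strings (A_ n)) s k.
    move=> kn; apply: eq_num_ext => t tk.
    by rewrite /S size_cat sz tk leq_add2l kn.
  rewrite (@eq_num_ext _ S); last first.
    by move=> t tm; rewrite nP /S size_cat sz tm leq_add2l// mn.
  rewrite mul1n leqNgt; apply/negP => sparse.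
  have := @sparse_mono 1 2 _ s _ _ tS mn; rewrite mul1n => /(_ sparse).
  by rewrite ES// mul1n ltnNge hA.
exists (Stage (level p) (leaves p) (predI (reservoir p) (strings A))); split.
- split=> //=; last first.
  + move=> s ps; have [sz _] := pz _ ps; split=> //; exists 4.
    by apply: dense_meet; [exact: pd|exact: denseA].
  + by exists s0.
  + by move=> s b /andP[/= /tQ Qs /subA As]; apply/andP.
- split=> //= [s /andP[]//|s ps|s ps].
  + by have [sz _] := pz _ ps; rewrite -sz take_size.
  + by exists [::]; rewrite cats0.
- move=> P [pP PA eP]; have [B BE] := strings_surj P; exists x => ev.
  rewrite -BE image_string_code in ev.
  have [s sP] := run_complete ev.
  have [n [sn nP]] := lim (level p + s); have [pn _] := (A_P n).1.
  have AnP t : size t <= level p + s -> P t -> strings (A_ n) t.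
    by move=> ts /PA /andP[_]; rewrite -nP.
  pose T t := strings (A_ n) t && P (take (level p + s) t).
  have TP t : size t <= level p + s -> T t = P t.
    move=> ts; rewrite /T take_oversize// andbC.
    by case Pt : (P t) => //=; exact: AnP.
  have [A' A'E] := strings_surj T.
  apply: ((A_P n).2 A').
    rewrite A'E; split.
    + move=> t tn; have [ts|ts] := ltnP (size t) (level p + s).
        by rewrite !TP ?size_rcons//; [exact: (pP _ _ (ltnSn _))|exact: ltnW].
      by rewrite /T -!cats1 !takel_cat// !cats1 -andb_orl pn.
    + by move=> t tl; rewrite TP ?tl ?leq_addr// eP.
    + by move=> t _ /andP[].
  have sh : s <= level p + n.
    by rewrite (leq_trans _ (leq_addl _ _))// (leq_trans _ sn)// leq_addl.
  apply: sP => // m ms; rewrite /query ifT; last exact: leq_trans sh.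
  rewrite charE; congr (nat_of_bool _).+1.
  apply: (@pred_agree_on_strings _ _ (level p + s)).
    by rewrite BE A'E.
  by rewrite (leq_trans (ltnW ms))// leq_addl.
Qed.

Lemma avoid_step p : ~ computable X -> valid p -> dense_leaves p ->
  exists q, [/\ valid q, extends p q & avoids q].
Proof.
move=> nX vp pd; apply: contrapT => nq; apply: nX.
apply: (@computable_of_forces _ c (level p) (leaves p)).
- move=> x; apply: contrapT => /forallNP nf; apply: nq.
  exact: avoid_by_thinning nf.
- move=> n x v f; apply: contrapT => vX; apply: nq.
  exact: avoid_by_extension f vX.
Qed.

End Decide.

(** The condition q that defeats c is followed by another step towards density,
    as the reservoir may have become thinner, before the leaves split. *)
Lemma next_stage X c p : ~ computable X -> valid p -> exists q r,
  [/\ valid r, extends p q, extends q r, splits p r & avoids X c q].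
Proof.
move=> nX vp.
have [q1 [vq1 e1 d1]] := dense_step vp.
have [q2 [vq2 e2 a2]] := avoid_step c nX vq1 d1.
have [q3 [vq3 e3 d3]] := dense_step vq2.
have [r [vr e4 [lr sr]]] := split_step vq3 d3.
have e13 : extends p q3 := extends_trans (extends_trans e1 e2) e3.
exists q2, r; split=> //; [exact: extends_trans e2|exact: extends_trans e4|].
split; first by apply: leq_ltn_trans lr; case: e13.
move=> s ps; have [_ _ _ /(_ _ ps)[t qt]] := e13.
have [u [v [uv uNv ru rv]]] := sr _ qt.
exists (t ++ u), (t ++ v); rewrite !catA; split=> //.
  by rewrite !size_cat uv.
by rewrite eqseq_cat// eqxx.
Qed.

Section Limit.
Variable p_ : nat -> stage.
Hypotheses (p_valid : forall k, valid (p_ k))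
  (p_extends : forall k, extends (p_ k) (p_ k.+1))
  (p_splits : forall k, splits (p_ k) (p_ k.+1)).

Definition limit_tree : pred (seq bool) := fun s =>
  `[< exists k t, leaves (p_ k) (s ++ t) >].

Lemma stage_extends j k : j <= k -> extends (p_ j) (p_ k).
Proof.
move=> /subnK <-; elim: (k - j) => [|d IH]; first exact: extends_refl.
exact: extends_trans IH (p_extends _).
Qed.

Lemma level_lt j k : j < k -> level (p_ j) < level (p_ k).
Proof.
by move=> /stage_extends[jk _ _ _]; apply: leq_trans jk; case: (p_splits j).
Qed.

Lemma level_ge k : k <= level (p_ k).
Proof.
by elim: k => // k IH; apply: leq_ltn_trans IH _; exact: level_lt.
Qed.

Lemma leaves_later j k s : j <= k -> leaves (p_ j) s ->
  exists t, leaves (p_ k) (s ++ t).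
Proof. by move=> /stage_extends[_ _ _]; apply. Qed.

Lemma limit_tree_later s : limit_tree s -> forall n,
  exists k t, n <= k /\ leaves (p_ k) (s ++ t).
Proof.
move=> /asboolP[j [t jt]] n; have [u pu] := leaves_later (leq_maxl j n) jt.
by exists (maxn j n), (t ++ u); rewrite leq_maxr catA.
Qed.

Lemma size_leaf k s : leaves (p_ k) s -> size s = level (p_ k).
Proof. by have [_ _ pz] := p_valid k; move=> /pz[]. Qed.

Lemma limit_tree_subtree : subtree limit_tree.
Proof.
move=> s b /asboolP[k [t kt]]; apply/asboolP; exists k, (b :: t).
by rewrite -cat_rcons.
Qed.

Lemma limit_tree_pruned h : pruned h limit_tree.
Proof.
move=> s _; apply/idP/orP => [/limit_tree_later|[]/limit_tree_subtree//].
move=> /(_ (size s).+1)[k [t [sk kt]]].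
case: t kt => [|b t] kt.
  by move: (size_leaf kt) (level_ge k); rewrite cats0 => <-; rewrite leqNgt sk.
by case: b kt => kt; [right|left]; apply/asboolP; exists k, t;
  rewrite cat_rcons.
Qed.

Lemma limit_tree_reservoir k s : limit_tree s -> reservoir (p_ k) s.
Proof.
move=> /limit_tree_later/(_ k)[j [t [kj jt]]].
have [_ sub _ _] := stage_extends kj; apply: sub.
have [tQ _ pz] := p_valid j; apply: (subtree_cat (t := t) tQ).
by apply: fat_mem; case: (pz _ jt).
Qed.

(** The conditions that defeat the programs do not occur in the sequence
    themselves, but each of them is followed by a stage. *)
Lemma limit_tree_compatible k q : extends q (p_ k.+1) ->
  compatible limit_tree q.
Proof.
move=> eqk; have [_ Rqk _ eqk'] := eqk.
split=> [|s /(limit_tree_reservoir k.+1)/Rqk//|s sz].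
  exact: limit_tree_pruned.
apply/idP/idP => [/limit_tree_later/(_ k.+1)[j [t [/stage_extends ekj jt]]]|qs].
  by have [_ _ /(_ _ jt)] := extends_trans eqk ekj; rewrite -sz take_size_cat.
by have [t kt] := eqk' _ qs; apply/asboolP; exists k.+1, t.
Qed.

Lemma limit_tree_split s : limit_tree s -> exists t u,
  [/\ size t = size u, t != u, limit_tree (s ++ t) & limit_tree (s ++ u)].
Proof.
move=> /asboolP[k [t kt]].
have [_ /(_ _ kt)[u [v [uv uNv ku kv]]]] := p_splits k.
exists (t ++ u), (t ++ v); rewrite !size_cat uv eqseq_cat// eqxx /=; split=> //;
  by apply/asboolP; exists k.+1, [::]; rewrite cats0 catA.
Qed.

Lemma limit_tree_root : limit_tree [::].
Proof. by have [_ [s s0] _] := p_valid 0; apply/asboolP; exists 0, s. Qed.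

Lemma limit_tree_perfect : perfect_tree [set s | limit_tree s].
Proof.
apply: perfect_tree_of_splitting limit_tree_root _ limit_tree_split => h.
exact: limit_tree_pruned.
Qed.

End Limit.

Theorem theorem2p5 (R : realType) (T : set (seq bool)) (X : set nat)
    (hT : is_tree T)
    (hmu : (0 < cantor_measure R (paths T))%E)
    (hX : ~ computable X) :
  exists P : set (seq bool),
    [/\ perfect_tree P, P `<=` T
      & ~ turing_reducible X (string_code @` P)].
Proof.
have tT : subtree (fun s => `[< T s >]).
  move=> s b /asboolP Tsb; apply/asboolP; apply: hT Tsb; exact: prefix_rcons.
pose p0 := Stage 0 (pred1 [::]) (fun s => `[< T s >]).
have vp0 : valid p0.
  split=> //=; first by exists [::].
  by move=> s /eqP->; split=> //; exact: fat_root hmu.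
have [u uP] := code_enumeration.
have /choice[next nextP] : forall kp : nat * {p | valid p},
    exists r : {p | valid p}, splits (sval kp.2) (sval r) /\
      exists q, [/\ extends (sval kp.2) q, extends q (sval r)
        & avoids X (u kp.1) q].
  move=> [k [p vp]].
  have [q [r [vr pq qr pr aq]]] := next_stage (u k) hX vp.
  by exists (exist _ r vr); split=> //; exists q.
pose fix ps k := if k is k'.+1 then next (k', ps k') else exist _ p0 vp0.
pose p_ k := sval (ps k).
have p_valid k : valid (p_ k) := svalP (ps k).
have p_splits k : splits (p_ k) (p_ k.+1) by case: (nextP (k, ps k)).
have p_next k : exists q, [/\ extends (p_ k) q, extends q (p_ k.+1)
    & avoids X (u k) q] by case: (nextP (k, ps k)).
have p_extends k : extends (p_ k) (p_ k.+1).
  by have [q [pq qp _]] := p_next k; exact: extends_trans qp.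
exists [set s | limit_tree p_ s]; split.
- exact: limit_tree_perfect.
- move=> s Ps; apply/asboolP.
  exact: (limit_tree_reservoir p_valid p_extends 0 Ps).
- move=> [c cP]; have [k kc] := uP c; subst c.
  have [q [_ qp aq]] := p_next k.
  have [x] := aq _ (limit_tree_compatible p_valid p_extends p_splits qp).
  by apply; exact: cP.
Qed.
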